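(* Let $R$ be a commutative ring with identity, and let $Q$ be as in the context (linear, symplectic or orthogonal case). Then $\mathrm{T}(Q)=\mathrm{ET}(Q)$. Hence $\mathrm{ET}(Q)$ is a normal subgroup of $\mathrm{G}(Q)$.
   Context: For an $R$-module $M$, $M^*=\mathrm{Hom}_R(M,R)$; an element $m\in M$ is unimodular if $f(m)=1$ for some $f\in M^*$; $\varphi\in M^*$ is unimodular (for $M$ finitely generated projective) if $\varphi(m)=1$ for some $m\in M$. Three cases are treated in parallel. Linear case: $P$ is a finitely generated projective $R$-module, $Q=P\oplus R$, and $Q$ has constant rank $\ge 3$. $\mathrm{G}(Q)=\mathrm{Aut}_R(Q)$. A transvection of $Q$ is an automorphism $x\mapsto x+\varphi(x)q$ with $q\in Q$, $\varphi\in Q^*$, $\varphi(q)=0$, and $q$ or $\varphi$ unimodular. The elementary transvections are $(p,a)\mapsto (p+ax,a)$ and $(p,a)\mapsto (p,a+\psi(p))$ with $x\in P$, $\psi\in P^*$. Symplectic case: $2$ is invertible in $R$; $P$ is a finitely generated projective $R$-module with a nonsingular (i.e. $p\mapsto\langle p,\cdot\rangle$ is an isomorphism $P\to P^*$) alternating bilinear form; $Q=P\perp R^2$ with form $\langle (p,b,a),(p',b',a')\rangle=\langle p,p'\rangle+ba'-ab'$. $\mathrm{G}(Q)=\mathrm{Sp}(Q)$ is the isometry group. A transvection is an isometry $x\mapsto x+\langle u,x\rangle v+\langle v,x\rangle u+\langle u,x\rangle u$ with $u,v\in Q$, $\langle u,v\rangle=0$, and $v$ unimodular in $Q$ or $\langle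 u,\cdot\rangle$ unimodular in $Q^*$. The elementary transvections are $(p,b,a)\mapsto(p+aq,\,b-\langle p,q\rangle+a,\,a)$ and $(p,b,a)\mapsto(p+bq,\,b,\,a+\langle p,q\rangle-b)$ with $q\in P$. Orthogonal case: $2$ is invertible in $R$; $P$ is a finitely generated projective $R$-module with a nonsingular symmetric bilinear form; $Q=P\perp R^2$ with form $\langle (p,b,a),(p',b',a')\rangle=\langle p,p'\rangle+ba'+ab'$. $\mathrm{G}(Q)=\mathrm{O}(Q)$ is the isometry group. A transvection is an isometry $x\mapsto x-\langle u,x\rangle v+\langle v,x\rangle u$ with $u,v\in Q$, $\langle u,u\rangle=\langle v,v\rangle=\langle u,v\rangle=0$, and $v$ unimodular in $Q$ or $\langle u,\cdot\rangle$ unimodular in $Q^*$. The elementary transvections are $(p,b,a)\mapsto(p-aq,\,b+\langle p,q\rangle,\,a)$ and $(p,b,a)\mapsto(p-bq,\,b,\,a+\langle p,q\rangle)$ with $q\in P$ isotropic ($\langle q,q\rangle=0$). In the symplectic and orthogonal cases it is assumed that there is a fixed integer $m\ge 3$ such that, for every maximal ideal $\mathfrak m$ of $R$, $Q_{\mathfrak m}$ is isometric to $\mathbb H(R_{\mathfrak m}^m)=R_{\mathfrak m}^m\oplus (R_{\mathfrak m}^m)^*$ with form $\langle(x,f),(x',f')\rangle=f(x')-f'(x)$ (symplectic) or $f(x')+f'(x)$ (orthogonal). $\mathrm{T}(Q)$ and $\mathrm{ET}(Q)$ are the subgroups of $\mathrm{G}(Q)$ generated by all transvections, respectively by the elementary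 transvections. *)

(* Defs.v *)
From HB Require Import structures.
From mathcomp Require Import all_boot all_order all_algebra.
From mathcomp Require Import all_classical.
From mathcomp Require Import ring.

Set Implicit Arguments.
Unset Strict Implicit.
Unset Printing Implicit Defensive.

Import GRing.Theory.
Local Open Scope ring_scope.
Local Open Scope quotient_scope.
Local Open Scope classical_set_scope.

(* Everything is over a [comPzRingType]: the zero ring is allowed. *)

Section Ideals.
Variable R : comPzRingType.
Implicit Types I J : set R.

Definition ideal I : Prop :=
  [/\ I 0, forall x y, I x -> I y -> I (x + y) & forall a x, I x -> I (a * x)].

Definition prime_ideal I : Prop :=
  [/\ ideal I, ~ I 1 & forall x y, I (x * y) -> I x \/ I y].

Definition maximal_ideal I : Prop :=
  [/\ ideal I, ~ I 1 & forall J, ideal J -> ~ J 1 -> I `<=` J -> J = I].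

Lemma maximal_prime I : maximal_ideal I -> prime_ideal I.
Proof.
move=> [[I0 ID IM] I1 Imax]; split=> // x y Ixy.
have [Ix|nIx] := pselect (I x); [by left | right].
pose J := [set z | exists a i, I i /\ z = a * x + i].
have idJ : ideal J.
  split.
  - by exists 0, 0; rewrite mul0r addr0.
  - move=> _ _ [a [i [Ii ->]]] [b [j [Ij ->]]]; exists (a + b), (i + j).
    by split; [exact: ID | rewrite mulrDl addrACA].
  - move=> c _ [a [i [Ii ->]]]; exists (c * a), (c * i).
    by split; [exact: IM | rewrite mulrDr mulrA].
have IJ : I `<=` J by move=> z Iz; exists 0, z; rewrite mul0r add0r.
have [[a [i [Ii e1]]]|nJ1] := pselect (J 1).
  rewrite -[y]mul1r e1 mulrDl -mulrA; apply: ID; first exact: IM.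
  by rewrite mulrC; exact: IM.
have JI := Imax J idJ nJ1 IJ.
by case: nIx; rewrite -JI; exists 1, 0; rewrite mul1r addr0.
Qed.

Section Complement.
Variables (I : set R) (primeI : prime_ideal I).

Definition compl_pred of prime_ideal I : {pred R} := fun x => `[< ~ I x >].

Fact compl_closed : mulr_closed (compl_pred primeI).
Proof.
have [_ I1 IP] := primeI; split=> [|x y /asboolP nx /asboolP ny]; apply/asboolP => //.
by case/IP.
Qed.

HB.instance Definition _ :=
  GRing.isMulClosed.Build R (compl_pred primeI) compl_closed.

Definition compl : mulrClosed R := compl_pred primeI.

End Complement.
End Ideals.

(* [locmod S M] is the localization S^-1 M, the quotient of the set of pairs
   (x, s) with s in S by (x, s) ~ (y, t) <-> u t x = u s y for some u in S. *)
Section Localization.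
Variables (R : comPzRingType) (S : mulrClosed R).

Definition denom := {s : R | s \in S}.

Definition denom1 : denom := exist _ 1 (rpred1 _).
Definition denomM (s t : denom) : denom :=
  exist _ (sval s * sval t) (rpredM (valP s) (valP t)).

Section Module.
Variable M : lmodType R.
Implicit Types (x y z : M) (s t : denom).

Definition frac_eq (p q : M * denom) : bool :=
  `[< exists2 u : R, u \in S & (u * sval q.2) *: p.1 = (u * sval p.2) *: q.1 >].

Fact frac_eq_equiv : equiv_class_of frac_eq.
Proof.
split=> [p|p q|q p r].
- by apply/asboolP; exists 1; rewrite ?rpred1.
- by apply/asboolP/asboolP => -[u uS e]; exists u.
- move=> /asboolP[u uS e] /asboolP[v vS f]; apply/asboolP.
  exists (u * v * sval q.2); first by rewrite !rpredM // (valP q.2).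
  have -> : u * v * sval q.2 * sval r.2 = v * sval r.2 * (u * sval q.2) by ring.
  rewrite -scalerA e scalerA.
  have -> : v * sval r.2 * (u * sval p.2) = u * sval p.2 * (v * sval r.2) by ring.
  by rewrite -scalerA f scalerA; congr (_ *: _); ring.
Qed.

Canonical frac_eq_rel := EquivRelPack frac_eq_equiv.

Definition locmod := {eq_quot frac_eq}.
HB.instance Definition _ := Choice.on locmod.
HB.instance Definition _ := EqQuotient.on locmod.

Definition frac (x : M) (s : denom) : locmod := \pi_locmod (x, s).

Lemma fracP x s y t :
  frac x s = frac y t <->
  exists2 u, u \in S & (u * sval t) *: x = (u * sval s) *: y.
Proof.
split=> [/eqquotP/asboolP[u uS e]|[u uS e]]; first by exists u.
by apply/eqquotP/asboolP; exists u.
Qed.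

Variant frac_spec : locmod -> Prop := FracSpec x s : frac_spec (frac x s).

Lemma fracW (p : locmod) : frac_spec p.
Proof. by elim/quotW: p => -[x s]; exact: FracSpec. Qed.

(* Operations on fractions are computed on representatives; [opp_frac],
   [add_frac], [mul_frac], [scale_frac] and [loc_formE] show that the result
   does not depend on their choice. *)
Definition loc_zero : locmod := frac 0 denom1.
Definition loc_opp (p : locmod) : locmod := frac (- (repr p).1) (repr p).2.
Definition loc_add (p q : locmod) : locmod :=
  frac (sval (repr q).2 *: (repr p).1 + sval (repr p).2 *: (repr q).1)
       (denomM (repr p).2 (repr q).2).

Lemma repr_frac x s : exists2 u, u \in S &
  (u * sval s) *: (repr (frac x s)).1 = (u * sval (repr (frac x s)).2) *: x.
Proof. by apply/fracP; rewrite /frac -surjective_pairing reprK. Qed.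

Fact opp_frac x s : loc_opp (frac x s) = frac (- x) s.
Proof.
have [u uS e] := repr_frac x s.
by apply/fracP; exists u => //; rewrite !scalerN e.
Qed.

Fact add_frac x s y t :
  loc_add (frac x s) (frac y t) = frac (sval t *: x + sval s *: y) (denomM s t).
Proof.
have [u uS e] := repr_frac x s; have [v vS f] := repr_frac y t.
apply/fracP; exists (u * v); first exact: rpredM.
move: (repr (frac x s)) (repr (frac y t)) e f => [x' s'] [y' t'] /= e f.
rewrite !scalerDr !scalerA; congr (_ + _).
  have -> : u * v * (sval s * sval t) * sval t' = (v * sval t * sval t') * (u * sval s) by ring.
  by rewrite -scalerA e scalerA; congr (_ *: _); ring.
have -> : u * v * (sval s * sval t) * sval s' = (u * sval s * sval s') * (v * sval t) by ring.
by rewrite -scalerA f scalerA; congr (_ *: _); ring.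
Qed.

Fact frac_congr x y s t : sval t *: x = sval s *: y -> frac x s = frac y t.
Proof. by move=> e; apply/fracP; exists 1; rewrite ?rpred1 // !mul1r. Qed.

Fact loc_addA : associative loc_add.
Proof.
move=> p q r; case: p / fracW => x s; case: q / fracW => y t; case: r / fracW => z w.
rewrite !add_frac; apply: frac_congr => /=.
by rewrite !scalerDr !scalerA addrA; do 2?congr (_ + _); congr (_ *: _); ring.
Qed.

Fact loc_addC : commutative loc_add.
Proof.
move=> p q; case: p / fracW => x s; case: q / fracW => y t.
rewrite !add_frac; apply: frac_congr => /=.
by rewrite !scalerDr !scalerA addrC; congr (_ + _); congr (_ *: _); ring.
Qed.

Fact loc_add0 : left_id loc_zero loc_add.
Proof.
move=> p; case: p / fracW => x s; rewrite add_frac; apply: frac_congr => /=.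
by rewrite scaler0 add0r scalerA; congr (_ *: _); ring.
Qed.

Fact loc_addN : left_inverse loc_zero loc_opp loc_add.
Proof.
move=> p; case: p / fracW => x s; rewrite opp_frac add_frac.
by apply: frac_congr => /=; rewrite scalerN addNr !scaler0.
Qed.

HB.instance Definition _ :=
  GRing.isZmodule.Build locmod loc_addA loc_addC loc_add0 loc_addN.
End Module.

Definition locring := locmod R^o.
HB.instance Definition _ := GRing.Zmodule.on locring.

Definition ringfrac (a : R) (s : denom) : locring := frac (a : R^o) s.

Variant ringfrac_spec : locring -> Prop :=
  RingFracSpec (a : R) s : ringfrac_spec (ringfrac a s).

Lemma ringfracW (p : locring) : ringfrac_spec p.
Proof. by case: p / fracW => a s; exact: RingFracSpec. Qed.

Lemma ringfrac_congr (a b : R) s t :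
  sval t * a = sval s * b -> ringfrac a s = ringfrac b t.
Proof. by move=> e; apply: frac_congr; exact: e. Qed.

Definition loc_one : locring := ringfrac 1 denom1.
Definition loc_mul (p q : locring) : locring :=
  ringfrac ((repr p).1 * (repr q).1) (denomM (repr p).2 (repr q).2).
Definition loc_scale (M : lmodType R) (p : locring) (q : locmod M) : locmod M :=
  frac (((repr p).1 : R) *: (repr q).1) (denomM (repr p).2 (repr q).2).

Section Scale.
Variable M : lmodType R.

Fact scale_frac (a : R) (s : denom) (x : M) (t : denom) :
  loc_scale (ringfrac a s) (frac x t) = frac (a *: x) (denomM s t).
Proof.
have [u uS e] := repr_frac (a : R^o) s; have [v vS f] := repr_frac x t.
apply/fracP; exists (u * v); first exact: rpredM.
rewrite /ringfrac.
move: (repr (frac _ s)) (repr (frac x t)) e f => [b s'] [y t'] /= e f.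
have {}e : u * sval s * b = u * sval s' * a by exact: e.
rewrite !scalerA.
have -> : u * v * (sval s * sval t) * b = (u * sval s * b) * (v * sval t) by ring.
by rewrite -scalerA f scalerA e; congr (_ *: _); ring.
Qed.
End Scale.

Fact mul_frac (a : R) (s : denom) (b : R) (t : denom) :
  loc_mul (ringfrac a s) (ringfrac b t) = ringfrac (a * b) (denomM s t).
Proof. exact: (@scale_frac R^o). Qed.

Fact add_ringfrac (a : R) (s : denom) (b : R) (t : denom) :
  ringfrac a s + ringfrac b t = ringfrac (sval t * a + sval s * b) (denomM s t).
Proof. exact: (@add_frac R^o). Qed.

Fact loc_mulA : associative loc_mul.
Proof.
move=> p q r; case: p / ringfracW => x s; case: q / ringfracW => y t; case: r / ringfracW => z w.
rewrite !mul_frac; apply: ringfrac_congr => /=; ring.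
Qed.

Fact loc_mulC : commutative loc_mul.
Proof.
move=> p q; case: p / ringfracW => x s; case: q / ringfracW => y t.
rewrite !mul_frac; apply: ringfrac_congr => /=; ring.
Qed.

Fact loc_mul1 : left_id loc_one loc_mul.
Proof.
move=> p; case: p / ringfracW => x s; rewrite mul_frac.
apply: ringfrac_congr => /=; ring.
Qed.

Fact loc_mulDl : left_distributive loc_mul +%R.
Proof.
move=> p q r; case: p / ringfracW => x s; case: q / ringfracW => y t; case: r / ringfracW => z w.
rewrite add_ringfrac !mul_frac add_ringfrac.
apply: ringfrac_congr => /=; ring.
Qed.

HB.instance Definition _ := GRing.Zmodule_isComPzRing.Build locring
  loc_mulA loc_mulC loc_mul1 loc_mulDl.

Section Lmodule.
Variable M : lmodType R.

Fact loc_scaleA (p q : locring) (x : locmod M) :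
  loc_scale p (loc_scale q x) = loc_scale (p * q) x.
Proof.
case: p / ringfracW => a s; case: q / ringfracW => b t; case: x / fracW => x w.
rewrite [_ * _]mul_frac !scale_frac; apply: frac_congr => /=.
by rewrite !scalerA; congr (_ *: _); ring.
Qed.

Fact loc_scale1 : left_id 1 (@loc_scale M).
Proof.
move=> x; case: x / fracW => x w; rewrite scale_frac.
by apply: frac_congr => /=; rewrite !scalerA; congr (_ *: _); ring.
Qed.

Fact loc_scaleDr : right_distributive (@loc_scale M) +%R.
Proof.
move=> p x y; case: p / ringfracW => a s; case: x / fracW => x t; case: y / fracW => y w.
rewrite [x in loc_scale _ x]add_frac !scale_frac [RHS]add_frac; apply: frac_congr => /=.
by rewrite !scalerDr !scalerA; congr (_ + _); congr (_ *: _); ring.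
Qed.

Fact loc_scaleDl (x : locmod M) : {morph (@loc_scale M)^~ x : p q / p + q}.
Proof.
move=> p q; case: p / ringfracW => a s; case: q / ringfracW => b t; case: x / fracW => x w.
rewrite add_ringfrac !scale_frac [RHS]add_frac; apply: frac_congr => /=.
rewrite !scalerDl !scalerDr !scalerA; congr (_ + _); congr (_ *: _); ring.
Qed.

HB.instance Definition _ := GRing.Zmodule_isLmodule.Build locring (locmod M)
  loc_scaleA loc_scale1 loc_scaleDr loc_scaleDl.
End Lmodule.
End Localization.

Section Modules.
Variable R : comPzRingType.

Definition fin_gen (M : lmodType R) : Prop :=
  exists n (g : 'I_n -> M), forall x, exists c : 'I_n -> R, x = \sum_i c i *: g i.

Definition projective (M : lmodType R) : Prop :=
  forall (A B : lmodType R) (g : {linear A -> B}) (h : {linear M -> B}),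
    (forall y, exists x, g x = y) ->
    exists k : {linear M -> A}, forall x, g (k x) = h x.

Definition isomorphic (M N : lmodType R) : Prop :=
  exists f : {linear M -> N}, bijective f.

Definition dual_pred (M : lmodType R) : {pred M -> R^o} :=
  fun f => `[< scalar (f : M -> R) >].

Section Dual.
Variable M : lmodType R.

Fact dual_closed : submod_closed (@dual_pred M).
Proof.
split=> [|a f g /asboolP fl /asboolP gl]; apply/asboolP => b x y.
  by rewrite mulr0 addr0.
change (a * f (b *: x + y) + g (b *: x + y) =
        b * (a * (f x : R) + (g x : R)) + (a * (f y : R) + (g y : R)) :> R).
by rewrite fl gl; ring.
Qed.
HB.instance Definition _ :=
  GRing.isSubmodClosed.Build R (M -> R^o) (@dual_pred M) dual_closed.

Record dual := Dual { dual_fun :> M -> R^o; _ : dual_fun \in @dual_pred M }.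
HB.instance Definition _ := [isSub for dual_fun].
HB.instance Definition _ := [Choice of dual by <:].
HB.instance Definition _ := [SubChoice_isSubLmodule of dual by <:].

Lemma dual_scalar (f : dual) : scalar (f : M -> R).
Proof. by case: f => f fP; exact: asboolW fP. Qed.

Lemma dual_linE (a : R) (f g : dual) (x : M) :
  (a *: f + g) x = a * f x + g x :> R.
Proof. by []. Qed.

Definition unimodular (x : M) : Prop := exists f : dual, f x = 1.

Definition unimodular_dual (f : dual) : Prop := exists x, f x = 1.
End Dual.
End Modules.

Definition loc_at (R : comPzRingType) (I : set R) (primeI : prime_ideal I) :
  comPzRingType := locring (compl primeI).

Definition locmod_at (R : comPzRingType) (I : set R) (primeI : prime_ideal I)
  (M : lmodType R) : lmodType (loc_at primeI) := locmod (compl primeI) M.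

Definition constant_rank (R : comPzRingType) (M : lmodType R) (n : nat) : Prop :=
  forall (I : set R) (primeI : prime_ideal I),
    isomorphic (locmod_at primeI M) 'rV[loc_at primeI]_n.

Section Forms.
Variable R : comPzRingType.

Definition bilinear_form (M : lmodType R) (b : M -> M -> R) : Prop :=
  (forall x, scalar (b x)) /\ (forall y, scalar (b^~ y)).

Record bilin (M : lmodType R) :=
  Bilin { bilin_fun :> M -> M -> R; bilinP : bilinear_form bilin_fun }.

Section BilinTheory.
Variables (M : lmodType R) (b : bilin M).

Let bl y : GRing.linear_for *%R (b^~ y) := (bilinP b).2 y.
Let br x : GRing.linear_for *%R (b x) := (bilinP b).1 x.

Lemma bilinDl x y z : b (x + y) z = b x z + b y z.
Proof. by rewrite -[x]scale1r bl mul1r scale1r. Qed.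
Lemma bilinDr x y z : b z (x + y) = b z x + b z y.
Proof. by rewrite -[x]scale1r br mul1r scale1r. Qed.
Lemma bilinZl a x y : b (a *: x) y = a * b x y.
Proof.
have b0 : b 0 y = 0 by apply: (addrI (b 0 y)); rewrite -bilinDl !addr0.
by rewrite -[a *: x]addr0 bl b0 addr0.
Qed.
Lemma bilinZr a x y : b y (a *: x) = a * b y x.
Proof.
have b0 : b y 0 = 0 by apply: (addrI (b y 0)); rewrite -bilinDr !addr0.
by rewrite -[a *: x]addr0 br b0 addr0.
Qed.
End BilinTheory.

Definition alternating_bilin (M : lmodType R) (b : bilin M) : Prop :=
  forall x, b x x = 0.

Definition symmetric_bilin (M : lmodType R) (b : bilin M) : Prop :=
  forall x y, b x y = b y x.

Section ToDual.
Variables (M : lmodType R) (b : bilin M).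

Definition to_dual (x : M) : dual M :=
  Dual (asboolT ((bilinP b).1 x)).

Fact to_dual_linear : linear to_dual.
Proof.
move=> a x y; apply/val_inj/funext => z /=.
exact: (bilinP b).2.
Qed.
HB.instance Definition _ :=
  GRing.isLinear.Build R M (dual M) *:%R to_dual to_dual_linear.

Definition nonsingular : Prop := bijective to_dual.
End ToDual.

Definition isometric (M N : lmodType R) (b : bilin M) (c : bilin N) : Prop :=
  exists2 f : {linear M -> N}, bijective f & forall x y, c (f x) (f y) = b x y.

(* In the triple (p, b, a), the vectors (0, 1, 0) and (0, 0, 1) form a
   hyperbolic pair. *)
Section PerpPlane.
Variables (P : lmodType R) (h : bilin P).

Definition perp2 : lmodType R := (P * R^o * R^o)%type.

Definition symp_perp2_fun (x y : perp2) : R :=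
  let: (p, b, a) := x in let: (p', b', a') := y in
  h p p' + b * a' - a * b'.

Definition orth_perp2_fun (x y : perp2) : R :=
  let: (p, b, a) := x in let: (p', b', a') := y in
  h p p' + b * a' + a * b'.

Fact symp_perp2_bilin : bilinear_form symp_perp2_fun.
Proof.
have [hl hr] := bilinP h.
split=> [[[p b] a]|[[p b] a]] c [[p' b'] a'] [[q d] e] /=.
  by rewrite hl /GRing.scale/=; ring.
by rewrite (hr p) /GRing.scale/=; ring.
Qed.

Fact orth_perp2_bilin : bilinear_form orth_perp2_fun.
Proof.
have [hl hr] := bilinP h.
split=> [[[p b] a]|[[p b] a]] c [[p' b'] a'] [[q d] e] /=.
  by rewrite hl /GRing.scale/=; ring.
by rewrite (hr p) /GRing.scale/=; ring.
Qed.

Definition symp_perp2 : bilin perp2 := Bilin symp_perp2_bilin.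
Definition orth_perp2 : bilin perp2 := Bilin orth_perp2_bilin.
End PerpPlane.

Section Hyperbolic.
Variable N : lmodType R.

Definition hyperbolic : lmodType R := (N * dual N)%type.

Definition symp_hyp_fun (x y : hyperbolic) : R := x.2 y.1 - y.2 x.1.
Definition orth_hyp_fun (x y : hyperbolic) : R := x.2 y.1 + y.2 x.1.

Fact symp_hyp_bilin : bilinear_form symp_hyp_fun.
Proof.
split=> -[x f] c [y g] [z k].
  change (f (c *: y + z) - (c *: g + k) x =
    c * ((f y : R) - g x) + ((f z : R) - k x) :> R).
  by rewrite dual_linE dual_scalar; ring.
change ((c *: g + k) x - f (c *: y + z) =
  c * ((g x : R) - f y) + ((k x : R) - f z) :> R).
by rewrite dual_linE dual_scalar; ring.
Qed.

Fact orth_hyp_bilin : bilinear_form orth_hyp_fun.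
Proof.
split=> -[x f] c [y g] [z k].
  change (f (c *: y + z) + (c *: g + k) x =
    c * ((f y : R) + g x) + ((f z : R) + k x) :> R).
  by rewrite dual_linE dual_scalar; ring.
change ((c *: g + k) x + f (c *: y + z) =
  c * ((g x : R) + f y) + ((k x : R) + f z) :> R).
by rewrite dual_linE dual_scalar; ring.
Qed.

Definition symp_hyp : bilin hyperbolic := Bilin symp_hyp_bilin.
Definition orth_hyp : bilin hyperbolic := Bilin orth_hyp_bilin.
End Hyperbolic.
End Forms.

Section LocForm.
Variables (R : comPzRingType) (S : mulrClosed R) (M : lmodType R) (b : bilin M).

Definition loc_form_fun (p q : locmod S M) : locring S :=
  ringfrac (b (repr p).1 (repr q).1) (denomM (repr p).2 (repr q).2).

Lemma loc_formE (x : M) (s : denom S) (y : M) (t : denom S) :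
  loc_form_fun (frac x s) (frac y t) = ringfrac (b x y) (denomM s t).
Proof.
have [u uS e] := repr_frac x s; have [v vS f] := repr_frac y t.
apply/fracP; exists (u * v); first exact: rpredM.
move: (repr (frac x s)) (repr (frac y t)) e f => [x' s'] [y' t'] /= e f.
rewrite /GRing.scale/=.
have -> : u * v * (sval s * sval t) * b x' y' =
          b ((u * sval s) *: x') ((v * sval t) *: y').
  by rewrite bilinZl bilinZr; ring.
by rewrite e f bilinZl bilinZr; ring.
Qed.

Fact loc_form_bilin : bilinear_form loc_form_fun.
Proof.
split=> p c q r; case: p / fracW => x s; case: q / fracW => y t;
  case: r / fracW => z w; case: c / ringfracW => a d;
  rewrite [_ *: _]scale_frac [_ + frac _ _]add_frac !loc_formE [_ * _]mul_frac
    add_ringfrac; apply: ringfrac_congr => /=;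
  rewrite ?(bilinDl, bilinDr) ?(bilinZl, bilinZr); ring.
Qed.

Definition loc_form : bilin (locmod S M) := Bilin loc_form_bilin.
End LocForm.

Section Automorphisms.
Variables (R : comPzRingType) (M : lmodType R).

Definition laut_pred : {pred M -> M} := fun f => `[< linear f /\ bijective f >].

Record laut := LAut { laut_fun :> M -> M; _ : laut_fun \in laut_pred }.
HB.instance Definition _ := [isSub for laut_fun].
HB.instance Definition _ := [Choice of laut by <:].

Implicit Types s t : laut.

Lemma laut_linear s : linear s.
Proof. by case: s => f fP; exact: (asboolW fP).1. Qed.

Lemma laut_bij s : bijective s.
Proof. by case: s => f fP; exact: (asboolW fP).2. Qed.

Fact laut_one_subproof : idfun \in laut_pred.
Proof. by apply/asboolP; split=> //; exists idfun. Qed.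

Fact laut_mul_subproof s t : (s \o t) \in laut_pred.
Proof.
apply/asboolP; split; last by apply: bij_comp; exact: laut_bij.
by move=> a x y /=; rewrite !laut_linear.
Qed.

Definition laut_inv_fun s : M -> M :=
  projT1 (cid (let: Bijective g sK gK := laut_bij s in
               ex_intro (fun g => cancel s g /\ cancel g s) g (conj sK gK))).

Fact laut_inv_funP s : cancel s (laut_inv_fun s) /\ cancel (laut_inv_fun s) s.
Proof. by rewrite /laut_inv_fun; case: cid. Qed.

Fact laut_inv_subproof s : laut_inv_fun s \in laut_pred.
Proof.
have [sK Ks] := laut_inv_funP s; apply/asboolP; split; last by exists s.
by move=> a x y; rewrite -[in LHS](Ks x) -[in LHS](Ks y) -laut_linear sK.
Qed.

Definition laut_one := LAut laut_one_subproof.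
Definition laut_mul s t := LAut (laut_mul_subproof s t).
Definition laut_inv s := LAut (laut_inv_subproof s).

Fact laut_mulA : associative laut_mul.
Proof. by move=> s t u; exact/val_inj. Qed.
Fact laut_mul1 : left_id laut_one laut_mul.
Proof. by move=> s; exact/val_inj. Qed.
Fact laut_mulr1 : right_id laut_one laut_mul.
Proof. by move=> s; exact/val_inj. Qed.
Fact laut_mulV : left_inverse laut_one laut_inv laut_mul.
Proof. by move=> s; apply/val_inj/funext => x /=; rewrite (laut_inv_funP s).1. Qed.
Fact laut_mulrV : right_inverse laut_one laut_inv laut_mul.
Proof. by move=> s; apply/val_inj/funext => x /=; rewrite (laut_inv_funP s).2. Qed.

HB.instance Definition _ :=
  isGroup.Build laut laut_mulA laut_mul1 laut_mulr1 laut_mulV laut_mulrV.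

Definition isometries (h : bilin M) : set laut :=
  [set s : laut | forall x y, h (s x) (s y) = h x y].
End Automorphisms.

Section Subgroups.
Local Open Scope group_scope.
Variable G : groupType.

Definition subgroup (H : set G) : Prop :=
  [/\ H 1, forall x y, H x -> H y -> H (x * y) & forall x, H x -> H x^-1].

Definition generated (A : set G) : set G := smallest subgroup A.

Definition normal_subgroup (H K : set G) : Prop :=
  [/\ subgroup H, H `<=` K & forall g x, K g -> H x -> H (g * x * g^-1)].
End Subgroups.

Section Linear.
Variables (R : comPzRingType).

Definition lin_transvection (Q : lmodType R) : set (laut Q) :=
  [set s : laut Q | exists (q : Q) (phi : dual Q),
     [/\ phi q = 0, unimodular q \/ unimodular_dual phi
       & forall x, s x = x + phi x *: q]].
Arguments lin_transvection : clear implicits.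

Variable P : lmodType R.

Definition lin_sum : lmodType R := (P * R^o)%type.

Definition lin_elementary : set (laut lin_sum) :=
  [set s : laut lin_sum |
     (exists x : P, forall p a, s (p, a) = (p + a *: x, a)) \/
     (exists psi : dual P, forall p a, s (p, a) = (p, a + psi p))].

Definition linG : set (laut lin_sum) := setT.
Definition linT : set (laut lin_sum) := generated (lin_transvection lin_sum).
Definition linET : set (laut lin_sum) := generated lin_elementary.
End Linear.
Arguments lin_elementary {R} P _.
Arguments linG {R} P _.
Arguments linT {R} P _.
Arguments linET {R} P _.

Section Symplectic.
Variables (R : comPzRingType).

Definition symp_transvection (Q : lmodType R) (h : bilin Q) : set (laut Q) :=
  [set s : laut Q | isometries h s /\ exists u v : Q,
     [/\ h u v = 0, unimodular v \/ unimodular_dual (to_dual h u)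
       & forall x, s x = x + h u x *: v + h v x *: u + h u x *: u]].

Variables (P : lmodType R) (h : bilin P).

Definition symp_elementary : set (laut (perp2 P)) :=
  [set s : laut (perp2 P) | isometries (symp_perp2 h) s /\ exists q : P,
     (forall p b a, s (p, b, a) = (p + a *: q, b - h p q + a, a)) \/
     (forall p b a, s (p, b, a) = (p + b *: q, b, a + h p q - b))].

Definition sympG : set (laut (perp2 P)) := isometries (symp_perp2 h).
Definition sympT : set (laut (perp2 P)) :=
  generated (symp_transvection (symp_perp2 h)).
Definition sympET : set (laut (perp2 P)) := generated symp_elementary.
End Symplectic.

Section Orthogonal.
Variables (R : comPzRingType).

Definition orth_transvection (Q : lmodType R) (h : bilin Q) : set (laut Q) :=
  [set s : laut Q | isometries h s /\ exists u v : Q,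
     [/\ [/\ h u u = 0, h v v = 0 & h u v = 0],
         unimodular v \/ unimodular_dual (to_dual h u)
       & forall x, s x = x - h u x *: v + h v x *: u]].

Variables (P : lmodType R) (h : bilin P).

Definition orth_elementary : set (laut (perp2 P)) :=
  [set s : laut (perp2 P) | isometries (orth_perp2 h) s /\ exists2 q : P, h q q = 0 &
     (forall p b a, s (p, b, a) = (p - a *: q, b + h p q, a)) \/
     (forall p b a, s (p, b, a) = (p - b *: q, b, a + h p q))].

Definition orthG : set (laut (perp2 P)) := isometries (orth_perp2 h).
Definition orthT : set (laut (perp2 P)) :=
  generated (orth_transvection (orth_perp2 h)).
Definition orthET : set (laut (perp2 P)) := generated orth_elementary.
End Orthogonal.

Section LocalHypothesis.
Variables (R : comPzRingType) (P : lmodType R) (h : bilin P) (m : nat).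

Definition symp_locally_hyperbolic : Prop :=
  forall (I : set R) (maxI : maximal_ideal I),
    let primeI := maximal_prime maxI in
    isometric (loc_form (compl primeI) (symp_perp2 h))
              (symp_hyp 'rV[loc_at primeI]_m).

Definition orth_locally_hyperbolic : Prop :=
  forall (I : set R) (maxI : maximal_ideal I),
    let primeI := maximal_prime maxI in
    isometric (loc_form (compl primeI) (orth_perp2 h))
              (orth_hyp 'rV[loc_at primeI]_m).
End LocalHypothesis.

Definition two_invertible (R : comPzRingType) : Prop := exists c : R, 2%:R * c = 1.

(* Main.v *)
Require Import Defs.
From HB Require Import structures.
From mathcomp Require Import all_boot all_order all_algebra.
From mathcomp Require Import all_classical.
From mathcomp Require Import ring.

(* A transvection moves in a one-parameter family (multiply [phi], respectively
   [v], by [r]), and the family is additive in [r]. So the scalars [r] all of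
   whose multiples give elements of ET(Q) form an ideal, and it suffices to find
   such an [r] outside each maximal ideal [I]. Clearing denominators in a basis
   of [Q_I] that is compatible with the splitting off of [R], respectively of
   the plane [R^2], gives explicit factorizations of the transvection with
   parameter a power of the common denominator, so no polynomial homotopy is
   needed.
   - Linear case: [phi = lambda(q) phi - phi(q) lambda] when [lambda(q) = 1], and
     each contraction of [q] with a decomposable 2-form yields a product of
     commutators of elementary transvections, already when [q] is arbitrary.
   - Symplectic case: if [<z', z> = t] with [z, z'] in [P], then [t u] is the sum of
     a vector of [P] and a vector orthogonal to [z] and [z']; this puts all the
     maps [x + c <u, x> u] in ET(Q), and [x + <u, x> v + <v, x> u] follows by
     polarization.
   - Orthogonal case: [v = <u, w> v - <u, v> w] when [<u, w> = 1], and the second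
     exterior power is spanned by the planes that are totally isotropic and
     orthogonal to a hyperbolic plane; for those a commutator formula applies. *)

Set Implicit Arguments.
Unset Strict Implicit.
Unset Printing Implicit Defensive.

Import GRing.Theory.
Local Open Scope ring_scope.
Local Open Scope classical_set_scope.

(** * Preliminaries *)

(* In the idealization [R + M] of a module, identities between linear combinations
   become identities in a commutative ring, which [ring] decides. *)
Section Nagata.
Variables (R : comPzRingType) (M : lmodType R).

Definition nagata : Type := (R * M)%type.
HB.instance Definition _ := GRing.Zmodule.on nagata.

Implicit Types p q : nagata.

Definition nagata_one : nagata := (1, 0).
Definition nagata_mul p q : nagata := (p.1 * q.1, p.1 *: q.2 + q.1 *: p.2).

Fact nagata_mulA : associative nagata_mul.
Proof.
move=> [a x] [b y] [c z]; congr (_, _) => /=; first exact: mulrA.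
by rewrite !scalerDr !scalerA addrA (mulrC c a) (mulrC c b).
Qed.
Fact nagata_mulC : commutative nagata_mul.
Proof. by move=> [a x] [b y]; congr (_, _) => /=; rewrite 1?mulrC 1?addrC. Qed.
Fact nagata_mul1 : left_id nagata_one nagata_mul.
Proof.
by move=> [a x]; congr (_, _); rewrite /= ?mul1r // scale1r scaler0 addr0.
Qed.
Fact nagata_mulDl : left_distributive nagata_mul +%R.
Proof.
move=> [a x] [b y] [c z]; congr (_, _) => /=; first exact: mulrDl.
by rewrite scalerDl scalerDr addrACA.
Qed.
HB.instance Definition _ := GRing.Zmodule_isComPzRing.Build nagata
  nagata_mulA nagata_mulC nagata_mul1 nagata_mulDl.

Definition nagata_scalar (a : R) : nagata := (a, 0).
Definition nagata_vector (x : M) : nagata := (0, x).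

Fact nagata_scalar_zmod : zmod_morphism nagata_scalar.
Proof. by move=> a b; congr (_, _); rewrite /= ?subr0. Qed.
HB.instance Definition _ :=
  GRing.isZmodMorphism.Build R nagata nagata_scalar nagata_scalar_zmod.
Fact nagata_scalar_monoid : monoid_morphism nagata_scalar.
Proof. by split=> // a b; congr (_, _); rewrite /= !scaler0 addr0. Qed.
HB.instance Definition _ :=
  GRing.isMonoidMorphism.Build R nagata nagata_scalar nagata_scalar_monoid.

Lemma nagata_vectorE : (nagata_vector 0 = 0) *
  ({morph nagata_vector : x y / x + y} * {morph nagata_vector : x / - x}) *
  (forall a x, nagata_vector (a *: x) = nagata_scalar a * nagata_vector x).
Proof.
do !split=> //.
- by move=> x y; congr (_, _); rewrite /= addr0.
- by move=> x; congr (_, _); rewrite /= oppr0.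
- by move=> a x; congr (_, _); rewrite /= ?mulr0 // scale0r addr0.
Qed.

Lemma nagata_vector_inj : injective nagata_vector.
Proof. by move=> x y []. Qed.
End Nagata.

Ltac module := apply: nagata_vector_inj; rewrite ?nagata_vectorE; ring.

(** * Local-global principle for ideals *)

Section LocalToGlobal.
Variable R : comPzRingType.

Lemma maximal_ideal_exists (J : set R) :
  ideal J -> ~ J 1 -> exists2 I, maximal_ideal I & J `<=` I.
Proof.
move=> [J0 JD JM] J1.
(* Imposing the condition on the union with [J] covers the empty chain as well: the empty set
   satisfies [proper_over] because [J] is a proper ideal. *)
pose proper_over (A : set R) := ideal (A `|` J) /\ ~ (A `|` J) 1.
have [F PF totF|A [[idA nA1] Amax]] := @Zorn_bigcup R proper_over.
  have FJ X x : F X -> X x -> (\bigcup_(X in F) X `|` J) x.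
    by move=> FX Xx; left; exists X.
  split=> [|[[X FX X1]|//]]; last by case: (PF X FX) => _; apply; left.
  split=> [|x y|a x [[X FX Xx]|Jx]]; first by right.
  - move=> [[X FX Xx]|Jx] [[Y FY Yy]|Jy].
    + have [XY|YX] := totF _ _ FX FY.
        have [[_ YD _] _] := PF Y FY.
        by case: (YD x y (or_introl (XY _ Xx)) (or_introl Yy)); [exact: FJ|right].
      have [[_ XD _] _] := PF X FX.
      by case: (XD x y (or_introl Xx) (or_introl (YX _ Yy))); [exact: FJ|right].
    + have [[_ XD _] _] := PF X FX.
      by case: (XD x y (or_introl Xx) (or_intror Jy)); [exact: FJ|right].
    + have [[_ YD _] _] := PF Y FY.
      by case: (YD x y (or_intror Jx) (or_introl Yy)); [exact: FJ|right].
    + by right; exact: JD.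
  - have [[_ _ XM] _] := PF X FX.
    by case: (XM a x (or_introl Xx)); [exact: FJ|right].
  - by right; exact: JM.
exists (A `|` J); last by move=> x; right.
split=> // K idK nK1 AK.
have AK' : A `<=` K by move=> x Ax; apply: AK; left.
have KJ : K `|` J = K by apply/seteqP; split=> x; [case=> // Jx; apply: AK; right|left].
have [KA|nKA] := pselect (K `<=` A).
  by apply/seteqP; split=> // x /KA; left.
by case: (Amax K); [split|rewrite /proper_over KJ].
Qed.

(** A proper [J] would lie in a maximal ideal [I], while the hypothesis provides an element of [J]
    outside [I]. *)
Lemma ideal_local (J : set R) :
  ideal J -> (forall I, maximal_ideal I -> exists2 x, J x & ~ I x) ->
  forall x, J x.
Proof.
move=> idJ Jloc x; have [_ _ JM] := idJ.
have [J1|nJ1] := pselect (J 1); first by rewrite -[x]mulr1; exact: JM.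
have [I maxI JI] := maximal_ideal_exists idJ nJ1.
by have [y /JI Iy] := Jloc I maxI.
Qed.
End LocalToGlobal.

(** * Subgroups, generators and the maps they realize *)

Section RealizedMaps.
Variables (R : comPzRingType) (M : lmodType R) (H : set (laut M)).
Hypothesis subgroupH : subgroup H.

(** Membership is stated for plain functions, so that factorizations can be checked pointwise
    without carrying proofs of linearity and bijectivity. *)
Definition realized (f : M -> M) : Prop := exists2 s : laut M, H s & s = f :> (M -> M).

Lemma realized_comp f g : realized f -> realized g -> realized (f \o g).
Proof.
by case: subgroupH => _ HM _ [s Hs <-] [t Ht <-]; exists (s * t)%g => //; exact: HM.
Qed.

Lemma realized_inv f g : realized f -> cancel f g -> realized g.
Proof.
case: subgroupH => _ _ HV [s Hs <-] sK; exists (s^-1)%g; first exact: HV.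
by apply/funext => x; rewrite -[LHS]sK; congr g; exact: (laut_inv_funP s).2.
Qed.
End RealizedMaps.

Section GroupLemmas.
Local Open Scope group_scope.
Variable G : groupType.

Lemma generated_subgroup (A : set G) : subgroup (generated A).
Proof.
split=> [X [[]//]|x y Ax Ay X XA|x Ax X XA]; have [[_ XM XV] _] := XA.
  by apply: XM; [exact: Ax|exact: Ay].
by apply: XV; exact: Ax.
Qed.

(** The elements that [g] conjugates into the generated subgroup form a subgroup, and it contains
    the generators. *)
Lemma generated_normal (A K : set G) : subgroup K -> A `<=` K ->
    (forall g x, K g -> A x -> A (g * x * g^-1)) ->
  normal_subgroup (generated A) K.
Proof.
move=> sK AK AJ; have sA := generated_subgroup A; have [A1 AM AV] := sA.
split=> // [|g x Kg]; first exact: smallest_sub.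
move: x; apply: (@smallest_sub _ _ _ [set x | generated A (g * x * g^-1)]) => [|x Ax].
  split=> [|x y Ax Ay|x Ax] /=; first by rewrite mulg1 mulgV.
  - have -> : g * (x * y) * g^-1 = (g * x * g^-1) * (g * y * g^-1).
      by rewrite !mulgA mulgVK.
    exact: AM.
  - have -> : g * x^-1 * g^-1 = (g * x * g^-1)^-1 by rewrite !invgM invgK mulgA.
    exact: AV.
by apply: sub_gen_smallest; exact: AJ.
Qed.

Lemma generated_eq (A B : set G) :
  A `<=` generated B -> B `<=` generated A -> generated A = generated B.
Proof.
move=> AB BA; apply/seteqP; split; apply: smallest_sub => //; exact: generated_subgroup.
Qed.
End GroupLemmas.

Section Bilin.
Variables (R : comPzRingType) (M : lmodType R) (b : bilin M).

Lemma bilin0l x : b 0 x = 0. Proof. by rewrite -[0](scale0r 0) bilinZl mul0r. Qed.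
Lemma bilin0r x : b x 0 = 0. Proof. by rewrite -[0](scale0r 0) bilinZr mul0r. Qed.
Lemma bilinNl x y : b (- x) y = - b x y.
Proof. by rewrite -scaleN1r bilinZl mulN1r. Qed.
Lemma bilinNr x y : b x (- y) = - b x y.
Proof. by rewrite -scaleN1r bilinZr mulN1r. Qed.

Definition bilinE := ((bilin0l, bilin0r), (bilinNl, bilinNr), (bilinZl b, bilinZr b),
  (bilinDl b, bilinDr b)).

Lemma bilin_sumr (I : finType) (F : I -> M) y : b y (\sum_i F i) = \sum_i b y (F i).
Proof. by apply: (big_morph (b y)) => [u v|]; rewrite ?bilinDr ?bilin0r. Qed.
End Bilin.

(** * Symplectic transvections *)

Section SymplecticMaps.
Variables (R : comPzRingType) (M : lmodType R) (B : bilin M).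
Hypothesis altB : alternating_bilin B.

Lemma alternating_skew x y : B y x = - B x y.
Proof.
have := altB (x + y); rewrite !bilinE !altB add0r addr0 addrC => /eqP.
by rewrite addr_eq0 => /eqP.
Qed.

(** A transvection has [c = 1]. The free parameter [c] makes the family closed under composition,
    and includes the long root maps ([w = 0]) and the polarized maps ([c = 0]), which are symmetric
    in [u] and [w]. *)
Definition symp_map (u w : M) (c : R) : M -> M :=
  fun x => x + B u x *: w + B w x *: u + (c * B u x) *: u.

(** For fixed [u] this is the law of a Heisenberg group with centre parametrized by [c]. *)
Lemma symp_map_comp u w w' c c' : B u w = 0 -> B u w' = 0 ->
  symp_map u w c \o symp_map u w' c' = symp_map u (w + w') (c + c' + B w w').
Proof.
move=> uw uw'; apply/funext => x; rewrite /symp_map /= !bilinE.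
rewrite uw' (alternating_skew u w) uw altB; module.
Qed.

Lemma symp_map_id u : symp_map u 0 0 = id.
Proof. by apply/funext => x; rewrite /symp_map bilinE; module. Qed.

Lemma symp_mapK u w c : B u w = 0 -> cancel (symp_map u w c) (symp_map u (- w) (- c)).
Proof.
move=> uw x; have := congr1 (@^~ x) (@symp_map_comp u (- w) w (- c) c _ uw).
by rewrite /= !bilinE altB uw oppr0 !addNr addr0 symp_map_id; exact.
Qed.

Lemma symp_map_swap u w : symp_map u w 0 = symp_map w u 0.
Proof. by apply/funext => x; rewrite /symp_map; module. Qed.

Lemma symp_mapZ r u w : symp_map (r *: u) w 0 = symp_map u (r *: w) 0.
Proof. by apply/funext => x; rewrite /symp_map !bilinE; module. Qed.

Lemma symp_map_conj (g : M -> M) u w c x : linear g ->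
  (forall x y, B (g x) (g y) = B x y) ->
  g (symp_map u w c x) = symp_map (g u) (g w) c (g x).
Proof.
move=> glin giso; rewrite /symp_map !giso.
have gZD a y z : g (z + a *: y) = g z + a *: g y by rewrite addrC glin addrC.
by rewrite !gZD.
Qed.

Lemma symp_map_linear u w c : linear (symp_map u w c).
Proof. by move=> a x y; rewrite /symp_map !bilinE; module. Qed.

Lemma symp_map_isometry u w c x y : B u w = 0 ->
  B (symp_map u w c x) (symp_map u w c y) = B x y.
Proof.
move=> uw; rewrite /symp_map !bilinE (alternating_skew u w) uw !altB.
by rewrite (alternating_skew u x) (alternating_skew w x); ring.
Qed.

(** Expand the quadratic expression in [u + w]. The three factors compose without cross terms
    because [u] and [w] span a totally isotropic submodule. *)
Lemma symp_map_add u w c : B u w = 0 ->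
  symp_map (u + w) 0 c =
    symp_map u 0 c \o (symp_map u (c *: w) 0 \o symp_map w 0 c).
Proof.
move=> uw; apply/funext => x; rewrite /symp_map /= !bilinE.
by rewrite uw !altB; module.
Qed.

(** * Symplectic maps in a set [D] closed under composition and inverses *)

Variable D : (M -> M) -> Prop.
Hypothesis D_comp : forall f g, D f -> D g -> D (f \o g).
Hypothesis D_inv : forall f g, D f -> cancel f g -> D g.

Lemma symp_D_inv u w c : B u w = 0 -> D (symp_map u w c) -> D (symp_map u (- w) (- c)).
Proof. by move=> uw Duw; apply: (D_inv Duw); exact: symp_mapK. Qed.

Lemma symp_D_add u w c w' c' : B u w = 0 -> B u w' = 0 ->
  D (symp_map u w c) -> D (symp_map u w' c') ->
  D (symp_map u (w + w') (c + c' + B w w')).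
Proof. by move=> uw uw' Dw Dw'; rewrite -symp_map_comp //; exact: D_comp. Qed.

Lemma symp_D_shift u w c c' : B u w = 0 ->
  D (symp_map u w c) -> D (symp_map u 0 c') -> D (symp_map u w (c + c')).
Proof.
move=> uw Dw D0; have := symp_D_add uw _ Dw D0.
by rewrite !bilinE !addr0; exact.
Qed.

(* The commutator of [symp_map z u 0] and [symp_map z' 0 c] is
   [symp_map u (- c t z') (c t^2)], where [t = B z' z]. *)
Lemma symp_D_commutator z z' u c : B u z = 0 -> B u z' = 0 ->
  D (symp_map z u 0) -> D (symp_map z' 0 c) ->
  (forall r, D (symp_map z' (r *: u) 0)) -> D (symp_map u 0 (c * B z' z ^+ 2)).
Proof.
move=> uz uz' Dzu Dz' Dzu'.
have zu : B z u = 0 by rewrite alternating_skew uz oppr0.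
have gz0 : B z' 0 = 0 by exact: bilin0r.
have DN : D (symp_map z (- u) 0).
  by have := symp_D_inv zu Dzu; rewrite oppr0.
have DN' : D (symp_map z' 0 (- c)).
  by have := symp_D_inv gz0 Dz'; rewrite oppr0.
(* The leftmost factor, read as a map with root [u], cancels the term [- c t z'] of the
   commutator. *)
have -> : symp_map u 0 (c * B z' z ^+ 2) =
    symp_map z' ((c * B z' z) *: u) 0 \o (symp_map z u 0 \o
     (symp_map z' 0 c \o (symp_map z (- u) 0 \o symp_map z' 0 (- c)))).
  (* A conjugate of [symp_map z (- u) 0]: the conjugating map sends [z] to [z + c t z'] and fixes
     [u]. *)
  have -> : symp_map z' 0 c \o (symp_map z (- u) 0 \o symp_map z' 0 (- c)) =
      symp_map (z + (c * B z' z) *: z') (- u) 0.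
    apply/funext => x /=; rewrite symp_map_conj.
    - have -> : symp_map z' 0 c (symp_map z' 0 (- c) x) = x.
        by have := symp_mapK (- c) gz0 x; rewrite oppr0 opprK.
      congr (symp_map _ _ _ _).
        by rewrite /symp_map !bilinE; module.
      rewrite /symp_map !bilinE (alternating_skew u z') uz'.
      by module.
    - exact: symp_map_linear.
    - by move=> y y'; exact: symp_map_isometry.
  have -> : symp_map (z + (c * B z' z) *: z') (- u) 0 =
            symp_map u (- (z + (c * B z' z) *: z')) 0.
    by apply/funext => x; rewrite /symp_map !bilinE; module.
  rewrite (symp_map_swap z u) symp_map_comp; last 2 first.
  - exact: uz.
  - by rewrite !bilinE uz uz'; ring.
  rewrite symp_map_swap symp_mapZ symp_map_comp; last 2 first.
  - by rewrite !bilinE uz' mulr0.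
  - by rewrite !bilinE uz uz'; ring.
  congr (symp_map _ _ _); first by module.
  by rewrite !bilinE !altB (alternating_skew z' z); ring.
by repeat (apply: D_comp => //).
Qed.

Variables (e f : M) (h : R).
Hypothesis ef1 : B e f = 1.
Hypothesis hE : 2%:R * h = 1.
Definition symp_perp (x : M) : Prop := B e x = 0 /\ B f x = 0.
Hypothesis De : forall q, symp_perp q -> D (symp_map e q 1).
Hypothesis Df : forall q, symp_perp q -> D (symp_map f q 1).
Hypothesis perp_local : forall I, maximal_ideal I ->
  exists2 z, symp_perp z & exists2 z', symp_perp z' & ~ I (B z z').

Lemma symp_perpZ c q : symp_perp q -> symp_perp (c *: q).
Proof. by move=> [eq fq]; rewrite /symp_perp !bilinE eq fq mulr0. Qed.
Lemma symp_perpD p q : symp_perp p -> symp_perp q -> symp_perp (p + q).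
Proof. by move=> [ep fp] [eq fq]; rewrite /symp_perp !bilinE ep fp eq fq addr0. Qed.
Lemma symp_perp0 : symp_perp 0.
Proof. by rewrite /symp_perp !bilinE. Qed.

Section Root.
Variable k : M.
Hypothesis Dk : forall q, symp_perp q -> D (symp_map k q 1).
Hypothesis kperp : forall q, symp_perp q -> B k q = 0.

(** The root [k] is [e] or [f]. The given map with [q = 0] is the long root map with parameter [1],
    and its inverse brings the parameter of the others from [1] to [0]. *)
Lemma symp_D_root0 q : symp_perp q -> D (symp_map k q 0).
Proof.
move=> Pq; rewrite -[0](subrr 1); apply: symp_D_shift; [exact: kperp|exact: Dk|].
have := symp_D_inv (kperp symp_perp0) (Dk symp_perp0).
by rewrite oppr0.
Qed.

(** In the Heisenberg group of [k], the commutator of the elements [y] and [z'] is central with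
    parameter [2 <y, z'>]. The choice [y = (h a) z] turns it into [a <z, z'>], and [<z, z'>] can be
    taken outside a given maximal ideal. *)
Lemma symp_D_root_long c : D (symp_map k 0 c).
Proof.
pose J : set R := [set c | forall a, D (symp_map k 0 (a * c))].
suff JT : forall x, J x by have := JT c 1; rewrite mul1r.
have k0 : B k 0 = 0 by exact: bilin0r.
apply: ideal_local.
  split=> [a|x y Jx Jy a|b x Jx a] /=.
  - by rewrite mulr0 symp_map_id -(symp_map_id k); have := symp_D_root0 symp_perp0.
  - by rewrite mulrDr; exact: (symp_D_shift k0 (Jx a) (Jy a)).
  - by rewrite mulrA; exact: Jx.
move=> I /perp_local[z Pz [z' Pz' Izz']]; exists (B z z') => // a.
have [y yE] : exists y, y = (h * a) *: z by eexists.
have Py : symp_perp y by rewrite yE; exact: symp_perpZ.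
have -> : symp_map k 0 (a * B z z') =
    symp_map k (y + z' + (-1 *: y + -1 *: z'))
      (0 + 0 + B y z' + (0 + 0 + B (-1 *: y) (-1 *: z')) +
       B (y + z') (-1 *: y + -1 *: z')).
  congr (symp_map _ _ _); first by module.
  rewrite !bilinE !altB (alternating_skew y z').
  suff -> : a * B z z' = 2%:R * B y z' by ring.
  by rewrite yE bilinE -[LHS]mul1r -[in LHS]hE; ring.
have [Ny Nz'] := (symp_perpZ (-1) Py, symp_perpZ (-1) Pz').
by do !apply: symp_D_add; (exact: symp_D_root0 || apply: kperp) => //; exact: symp_perpD.
Qed.

Lemma symp_D_root q c : symp_perp q -> D (symp_map k q c).
Proof.
move=> Pq; rewrite -[c]add0r; apply: symp_D_shift; first exact: kperp.
  exact: symp_D_root0.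
exact: symp_D_root_long.
Qed.
End Root.

Let perpe q : symp_perp q -> B e q = 0. Proof. by case. Qed.
Let perpf q : symp_perp q -> B f q = 0. Proof. by case. Qed.

(** The commutator formula for the hyperbolic pair [e], [f], where [t = -1]. *)
Lemma symp_D_perp_long z c : symp_perp z -> D (symp_map z 0 c).
Proof.
move=> [ez fz]; rewrite -[c]mulr1.
have <- : B f e ^+ 2 = 1 by rewrite (alternating_skew e f) ef1; ring.
apply: symp_D_commutator.
- by rewrite alternating_skew ez oppr0.
- by rewrite alternating_skew fz oppr0.
- exact: symp_D_root.
- exact: symp_D_root (symp_perp0).
- by move=> r; apply: symp_D_root => //; exact: symp_perpZ.
Qed.

(** Solves [symp_map_add] with [c = 1] for its middle factor. *)
Lemma symp_D_polarize u w : B u w = 0 ->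
  D (symp_map u 0 1) -> D (symp_map w 0 1) -> D (symp_map (u + w) 0 1) ->
  D (symp_map u w 0).
Proof.
move=> uw Du Dw Duw.
have DN v : D (symp_map v 0 1) -> D (symp_map v 0 (- 1)).
  by move/(symp_D_inv (bilin0r B v)); rewrite oppr0.
have -> : symp_map u w 0 =
    symp_map u 0 (-1) \o (symp_map (u + w) 0 1 \o symp_map w 0 (-1)).
  rewrite symp_map_add // scale1r.
  apply/funext => x /=.
  have E1 v := @symp_mapK v 0 (-1) (bilin0r B v).
  have E2 v := @symp_mapK v 0 1 (bilin0r B v).
  rewrite oppr0 in E2; rewrite oppr0 opprK in E1.
  have -> := E1 w x.
  by rewrite E2.
by apply: D_comp; [exact: DN|apply: D_comp => //; exact: DN].
Qed.

(** Split [w] along [e], [f] and a part [p] orthogonal to both. The map with [p] comes from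
    polarization; the other two have root [e] or [f] once their arguments are exchanged. *)
Lemma symp_D_perp z w c : symp_perp z -> B z w = 0 -> D (symp_map z w c).
Proof.
move=> Pz zw; rewrite -[c]add0r; apply: symp_D_shift => //; last first.
  exact: symp_D_perp_long.
have [ez fz] := Pz.
pose p := w - B w f *: e - B e w *: f.
have Pp : symp_perp p.
  rewrite /symp_perp /p !bilinE !altB (alternating_skew e f) ef1.
  by rewrite (alternating_skew f w); split; ring.
have ze : B z e = 0 by rewrite alternating_skew ez oppr0.
have zf : B z f = 0 by rewrite alternating_skew fz oppr0.
have zp : B z p = 0 by rewrite /p !bilinE zw ze zf; ring.
have Dp : D (symp_map z p 0).
  by apply: symp_D_polarize => //; apply: symp_D_perp_long => //; exact: symp_perpD.
have Dze r : D (symp_map z (r *: e) 0).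
  by rewrite symp_map_swap symp_mapZ; apply: symp_D_root => //; exact: symp_perpZ.
have Dzf r : D (symp_map z (r *: f) 0).
  by rewrite symp_map_swap symp_mapZ; apply: symp_D_root => //; exact: symp_perpZ.
have zre r : B z (r *: e) = 0 by rewrite !bilinE ze mulr0.
have zrf r : B z (r *: f) = 0 by rewrite !bilinE zf mulr0.
have D1 := symp_D_add zp (zre (B w f)) Dp (Dze _).
have zpe : B z (p + B w f *: e) = 0 by rewrite bilinDr zp zre addr0.
have := symp_D_add zpe (zrf (B e w)) D1 (Dzf _).
have -> : p + B w f *: e + B e w *: f = w by rewrite /p; module.
(* Composing the three parts leaves some third parameter [r], which the long root map with parameter
   [- r] removes. *)
set r := (X in symp_map _ _ X) => D2.
by rewrite -[0](subrr r); apply: symp_D_shift => //; exact: symp_D_perp_long.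
Qed.

Lemma symp_D_long u c : D (symp_map u 0 c).
Proof.
pose J : set R := [set c | forall a, D (symp_map u 0 (a * c))].
suff JT : forall x, J x by have := JT c 1; rewrite mul1r.
have u0 : B u 0 = 0 by exact: bilin0r.
apply: ideal_local.
  split=> [a|x y Jx Jy a|b x Jx a] /=.
  - have := @symp_D_perp 0 0 0 symp_perp0 (bilin0l _ _).
    by rewrite mulr0 !symp_map_id.
  - by rewrite mulrDr; exact: (symp_D_shift u0 (Jx a) (Jy a)).
  - by rewrite mulrA; exact: Jx.
move=> I maxI; have [z' Pz' [z Pz Izz']] := perp_local maxI.
(* Two factors [t] come from replacing [u] by [t u], in which the map is quadratic, and two from the
   commutator formula for [u'], the part of [t u] orthogonal to [z] and [z']. *)
set t := B z' z in Izz'; exists (t ^+ 4) => [a|].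
  have [u1 u1E] : exists y, y = B z' u *: z - B z u *: z' by eexists.
  have [u' u'E] : exists y, y = t *: u - u1 by eexists.
  have Pu1 : symp_perp u1.
    by rewrite u1E; apply: symp_perpD; [|rewrite -scaleNr]; exact: symp_perpZ.
  have zu' : B z u' = 0.
    by rewrite u'E u1E !bilinE altB (alternating_skew z' z) -/t; ring.
  have z'u' : B z' u' = 0.
    by rewrite u'E u1E !bilinE altB -/t; ring.
  have u1u' : B u1 u' = 0 by rewrite u1E !bilinE zu' z'u'; ring.
  have Du' r : D (symp_map u' 0 (r * t ^+ 2)).
    apply: symp_D_commutator.
    - by rewrite alternating_skew zu' oppr0.
    - by rewrite alternating_skew z'u' oppr0.
    - exact: symp_D_perp.
    - exact: symp_D_perp_long.
    - by move=> r'; apply: symp_D_perp; rewrite // !bilinE z'u' mulr0.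
  have -> : symp_map u 0 (a * t ^+ 4) = symp_map (u1 + u') 0 (a * t ^+ 2).
    have -> : u1 + u' = t *: u by rewrite u'E; module.
    by apply/funext => x; rewrite /symp_map !bilinE; module.
  rewrite symp_map_add //; apply: D_comp; first exact: symp_D_perp_long.
  by apply: D_comp => //; apply: symp_D_perp; rewrite // !bilinE u1u' mulr0.
have [_ _ IP] := maximal_prime maxI.
by rewrite !exprS expr0 mulr1; do 3!(case/IP => //).
Qed.

Lemma symp_D_all u w c : B u w = 0 -> D (symp_map u w c).
Proof.
move=> uw; rewrite -[c]add0r; apply: symp_D_shift => //; last exact: symp_D_long.
by apply: symp_D_polarize => //; exact: symp_D_long.
Qed.
End SymplecticMaps.

(** * Orthogonal transvections *)

Section OrthogonalMaps.
Variables (R : comPzRingType) (M : lmodType R) (B : bilin M) (h : R).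
Hypothesis symB : symmetric_bilin B.
Hypothesis hE : 2%:R * h = 1.

(** The Eichler-Siegel transformation. Its last term vanishes for isotropic [w], where it is a
    transvection; with this term the family is additive in every [w] orthogonal to an isotropic
    [u]. *)
Definition orth_map (u w : M) : M -> M :=
  fun x => x - B u x *: w + B w x *: u - (h * B w w * B u x) *: u.

Lemma orth_map_comp u w w' : B u u = 0 -> B u w = 0 -> B u w' = 0 ->
  orth_map u w \o orth_map u w' = orth_map u (w + w').
Proof.
move=> uu uw uw'; apply/funext => x; rewrite /orth_map /= !bilinE.
rewrite uu uw' (symB w u) uw (symB w' w).
have -> : h * (B w w + B w w' + (B w w' + B w' w')) =
  h * B w w + (2%:R * h) * B w w' + h * B w' w' by ring.
by rewrite hE; module.
Qed.

Lemma orth_map0 u : orth_map u 0 = id.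
Proof. by apply/funext => x; rewrite /orth_map !bilinE; module. Qed.

Lemma orth_mapK u w : B u u = 0 -> B u w = 0 -> cancel (orth_map u w) (orth_map u (- w)).
Proof.
move=> uu uw x; have := congr1 (@^~ x) (@orth_map_comp u (- w) w uu _ uw).
by rewrite /= !bilinE uw oppr0 !addNr orth_map0; exact.
Qed.

Lemma orth_map_swap u w : B u u = 0 -> B w w = 0 -> orth_map u w = orth_map w (- u).
Proof.
by move=> uu ww; apply/funext => x; rewrite /orth_map !bilinE uu ww; module.
Qed.

Lemma orth_mapZ r u w : orth_map (r *: u) w = orth_map u (r *: w).
Proof. by apply/funext => x; rewrite /orth_map !bilinE; module. Qed.

Lemma orth_map_collinear u r : B u u = 0 -> orth_map u (r *: u) = id.
Proof. by move=> uu; apply/funext => x; rewrite /orth_map !bilinE uu; module. Qed.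

Lemma orth_map_conj (g : M -> M) u w x : linear g ->
  (forall x y, B (g x) (g y) = B x y) ->
  g (orth_map u w x) = orth_map (g u) (g w) (g x).
Proof.
move=> glin giso; rewrite /orth_map !giso.
have gZD a y z : g (z + a *: y) = g z + a *: g y by rewrite addrC glin addrC.
by rewrite -!scaleNr !gZD.
Qed.

Lemma orth_map_linear u w : linear (orth_map u w).
Proof. by move=> a x y; rewrite /orth_map !bilinE; module. Qed.

Lemma orth_map_isometry u w x y : B u u = 0 -> B u w = 0 ->
  B (orth_map u w x) (orth_map u w y) = B x y.
Proof.
move=> uu uw; have wE : B w w = 2%:R * (h * B w w) by rewrite mulrA hE mul1r.
rewrite /orth_map !bilinE (symB w u) uu uw (symB x u) (symB x w).
move: (h * B w w) wE => q ->; ring.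
Qed.

(** * Orthogonal maps in a set [D] closed under composition and inverses *)

Variable D : (M -> M) -> Prop.
Hypothesis D_comp : forall f g, D f -> D g -> D (f \o g).
Hypothesis D_inv : forall f g, D f -> cancel f g -> D g.

Lemma orth_D_inv u w : B u u = 0 -> B u w = 0 -> D (orth_map u w) -> D (orth_map u (- w)).
Proof. by move=> uu uw Duw; apply: (D_inv Duw); exact: orth_mapK. Qed.

Lemma orth_D_add u w w' : B u u = 0 -> B u w = 0 -> B u w' = 0 ->
  D (orth_map u w) -> D (orth_map u w') -> D (orth_map u (w + w')).
Proof. by move=> uu uw uw' Dw Dw'; rewrite -orth_map_comp //; exact: D_comp. Qed.

(* The commutator of [orth_map z u] and [orth_map z' v] is
   [orth_map u (- t v - t q(v) z')], where [q(v) = h * B v v]. *)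
Lemma orth_D_commutator z z' u v :
  B z z = 0 -> B z' z' = 0 -> B u u = 0 ->
  B u z = 0 -> B u z' = 0 -> B v z = 0 -> B v z' = 0 -> B u v = 0 ->
  D (orth_map z u) -> D (orth_map z' v) ->
  (forall r, D (orth_map z' (r *: u))) -> D (orth_map u (B z z' *: v)).
Proof.
move=> zz z'z' uu uz uz' vz vz' uv Dzu Dz'v Dz'u.
have zu : B z u = 0 by rewrite symB.
have [zv z'v] : B z v = 0 /\ B z' v = 0 by rewrite !(symB _ v).
set t := B z z'; pose c := t * (h * B v v).
have uNv : B u (- (t *: v)) = 0 by rewrite !bilinE uv; ring.
rewrite -[_ *: v]opprK; apply: orth_D_inv => //.
(* The leftmost factor equals [orth_map u (c z')] and cancels the [z'] term of the commutator. *)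
have -> : orth_map u (- (t *: v)) = orth_map z' (- c *: u) \o (orth_map z u \o
     (orth_map z' v \o (orth_map z (- u) \o orth_map z' (- v)))).
  have -> : orth_map z' v \o (orth_map z (- u) \o orth_map z' (- v)) =
      orth_map (z - t *: v - c *: z') (- u).
    apply/funext => x /=; rewrite orth_map_conj.
    - have -> : orth_map z' v (orth_map z' (- v) x) = x.
        have := @orth_mapK z' (- v) z'z' _ x.
        by rewrite opprK !bilinE z'v oppr0; exact.
      congr (orth_map _ _ _).
        by rewrite /orth_map vz (symB z' z) -/t /c; module.
      by rewrite /orth_map !bilinE (symB z' u) uz' (symB v u) uv; module.
    - exact: orth_map_linear.
    - by move=> y y'; exact: orth_map_isometry.
  have NNu : B (- u) (- u) = 0 by rewrite !bilinE uu; ring.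
  rewrite (orth_map_swap (u := z - t *: v - c *: z')) //; last first.
    rewrite !bilinE vz vz' zv z'v zz z'z' (symB z' z) -/t.
    have -> : B v v = (2%:R * h) * B v v by rewrite hE mul1r.
    by rewrite /c; ring.
  rewrite -(scaleN1r u) orth_mapZ (orth_map_swap zz uu) orth_map_comp //; last 2 first.
  - by rewrite !bilinE uz oppr0.
  - by rewrite !bilinE uz uz' uv; ring.
  rewrite (orth_map_swap (u := z')) //; last by rewrite !bilinE uu; ring.
  rewrite -scaleNr orth_mapZ orth_map_comp //; last 2 first.
  - by rewrite !bilinE uz'; ring.
  - by rewrite !bilinE uz uz' uv; ring.
  by congr (orth_map _ _); module.
have Dinv z1 u1 : B z1 z1 = 0 -> B z1 u1 = 0 -> D (orth_map z1 u1) -> D (orth_map z1 (- u1)).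
  by exact: orth_D_inv.
by repeat (apply: D_comp => //); apply: Dinv.
Qed.

Definition good (z : M) : Prop :=
  B z z = 0 /\ forall w, B z w = 0 -> D (orth_map z w).

Lemma goodZ r z : good z -> good (r *: z).
Proof.
move=> [zz Dz]; split=> [|w]; first by rewrite !bilinE zz !mulr0.
rewrite bilinZl => rzw; rewrite orth_mapZ; apply: Dz.
by rewrite bilinZr.
Qed.

(** Here [t v] is a combination of [z] and [z'] plus a vector [v'] orthogonal to both. The
    commutator formula handles [t v'], and exchanging the arguments handles multiples of the good
    vectors [z] and [z']; hence the square of [t]. *)
Lemma good_pair z z' u v : good z -> good z' ->
  B u u = 0 -> B u z = 0 -> B u z' = 0 -> B u v = 0 ->
  D (orth_map u (B z z' ^+ 2 *: v)).
Proof.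
move=> gz gz' uu uz uz' uv; have [zz Dz] := gz; have [z'z' Dz'] := gz'.
set t := B z z'.
have [v1 v1E] : exists y, y = B z' v *: z + B z v *: z' by eexists.
have [v' v'E] : exists y, y = t *: v - v1 by eexists.
have Dcz r z1 : good z1 -> B u z1 = 0 -> D (orth_map u (r *: z1)).
  move=> gz1 uz1; have [z1z1 Dz1] := goodZ r gz1.
  rewrite orth_map_swap //; apply: Dz1.
  by rewrite !bilinE symB uz1; ring.
have zv' : B v' z = 0.
  by rewrite v'E v1E !bilinE zz (symB z' z) (symB v z) -/t; ring.
have z'v' : B v' z' = 0.
  by rewrite v'E v1E !bilinE z'z' (symB v z') -/t; ring.
have uv' : B u v' = 0 by rewrite v'E v1E !bilinE uv uz uz'; ring.
have -> : t ^+ 2 *: v = t *: v' + ((t * B z' v) *: z + (t * B z v) *: z').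
  by rewrite v'E v1E; module.
apply: orth_D_add => //.
- by rewrite bilinZr uv' mulr0.
- by rewrite !bilinE uz uz'; ring.
- apply: orth_D_commutator => //.
  + by apply: Dz; rewrite symB.
  + by apply: Dz'; rewrite symB.
  + by move=> r; apply: Dz'; rewrite bilinZr symB uz' mulr0.
apply: orth_D_add => //; try (by rewrite !bilinE ?uz ?uz' mulr0); exact: Dcz.
Qed.

Variables (e f : M).
Hypotheses (ee0 : B e e = 0) (ff0 : B f f = 0) (ef1 : B e f = 1).
Definition orth_perp (x : M) : Prop := B e x = 0 /\ B f x = 0.
Hypothesis De : forall q, orth_perp q -> B q q = 0 -> D (orth_map e q).
Hypothesis Df : forall q, orth_perp q -> B q q = 0 -> D (orth_map f q).

Lemma orth_perpZ c q : orth_perp q -> orth_perp (c *: q).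
Proof. by move=> [eq fq]; rewrite /orth_perp !bilinE eq fq mulr0. Qed.

Variable m : nat.

(** A local hyperbolic basis with denominators cleared, whose plane [i0] is the given one. Only [e]
    is scaled there, so that the two vectors of the plane still pair to [s]. *)
Definition adapted_frame (s : R) (g : 'I_m -> bool -> M) (i0 : 'I_m) : Prop :=
  [/\ forall i b j c, B (g i b) (g j c) = if (i == j) && (b != c) then s else 0,
      forall x, s *: x = \sum_i \sum_b B (g i (~~ b)) x *: g i b,
      g i0 true = s *: e, g i0 false = f
    & forall i b, i != i0 -> orth_perp (g i b)].

Hypothesis frame_local : forall I, maximal_ideal I ->
  exists s g i0, ~ I s /\ adapted_frame s g i0.

Section Root.
Variable k : M.
Hypothesis kk : B k k = 0.
Hypothesis kperp : forall q, orth_perp q -> B k q = 0.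
Hypothesis Dk : forall q, orth_perp q -> B q q = 0 -> D (orth_map k q).

(** Removes the isotropy condition on [q]: locally [s q] is a combination of frame vectors, each
    isotropic. Those of the plane [i0] have coefficient zero, the others are orthogonal to [e] and
    [f]. *)
Lemma orth_D_root q : orth_perp q -> D (orth_map k q).
Proof.
move=> Pq; have D0 : D (orth_map k 0).
  by apply: Dk; rewrite /orth_perp !bilinE.
pose J : set R := [set c | forall a, D (orth_map k ((a * c) *: q))].
suff JT : forall x, J x by have := JT 1 1; rewrite mulr1 scale1r.
have kq c : B k (c *: q) = 0 by rewrite bilinZr kperp // mulr0.
apply: ideal_local.
  split=> [a|x y Jx Jy a|b x Jx a] /=; first by rewrite mulr0 scale0r.
  - rewrite mulrDr scalerDl; exact: (orth_D_add kk (kq _) (kq _) (Jx a) (Jy a)).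
  - by rewrite mulrA; exact: Jx.
move=> I maxI; have [s [g [i0 [nIs [gB gC gt gf gP]]]]] := frame_local maxI.
exists s => // a; rewrite mulrC -scalerA gC.
pose K w := B k w = 0 /\ D (orth_map k w).
have K0 : K 0 by split; rewrite ?bilinE.
have KD w w' : K w -> K w' -> K (w + w').
  by move=> [kw Dw] [kw' Dw']; split; [rewrite bilinDr kw kw' addr0|exact: orth_D_add].
apply: (big_ind K K0 KD _).2 => i _; apply: (big_ind K K0 KD) => b _.
have [->|ni] := eqVneq i i0.
  have [eq fq] := Pq.
  have -> : B (g i0 (~~ b)) (a *: q) = 0.
    by case: b; rewrite /= ?gt ?gf !bilinE ?eq ?fq; ring.
  by rewrite scale0r.
have Pg := orth_perpZ (B (g i (~~ b)) (a *: q)) (gP i b ni).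
split; first exact: kperp.
by apply: Dk => //; rewrite !bilinE gB eqxx /=; case: (b); rewrite !mulr0.
Qed.
End Root.

Let perpe q : orth_perp q -> B e q = 0. Proof. by case. Qed.
Let perpf q : orth_perp q -> B f q = 0. Proof. by case. Qed.

(** A vector orthogonal to [e] differs from one orthogonal to both [e] and [f] by a multiple of [e],
    and such a multiple gives the identity map. *)
Lemma good_e : good e.
Proof.
split=> // w ew.
have [p pE] : exists y, y = w - B w f *: e by eexists.
have Pp : orth_perp p.
  by rewrite /orth_perp pE !bilinE ee0 ew (symB f w) (symB f e) ef1; split; ring.
have -> : w = p + B w f *: e by rewrite pE; module.
rewrite -orth_map_comp //; last 2 first.
- exact: perpe.
- by rewrite bilinZr ee0 mulr0.
by rewrite orth_map_collinear //; exact: orth_D_root.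
Qed.

Lemma good_f : good f.
Proof.
split=> // w fw.
have [p pE] : exists y, y = w - B w e *: f by eexists.
have Pp : orth_perp p.
  by rewrite /orth_perp pE !bilinE ff0 fw (symB e w) ef1; split; ring.
have -> : w = p + B w e *: f by rewrite pE; module.
rewrite -orth_map_comp //; last 2 first.
- exact: perpf.
- by rewrite bilinZr ff0 mulr0.
by rewrite orth_map_collinear //; exact: orth_D_root.
Qed.

Lemma good_perp z : orth_perp z -> B z z = 0 -> good z.
Proof.
move=> [ez fz] zz; split=> // w zw.
have [ze zf] : B z e = 0 /\ B z f = 0 by rewrite (symB z e) (symB z f).
by have := good_pair good_e good_f zz ze zf zw; rewrite ef1 expr1n scale1r.
Qed.

Hypothesis third_index : forall i j : 'I_m, exists2 k, k != i & k != j.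

Lemma orth_D_all u v w0 : B u u = 0 -> B u v = 0 -> B u w0 = 1 -> D (orth_map u v).
Proof.
move=> uu uv uw0.
have D0 : D (orth_map u 0).
  have [_ De'] := good_e; have := De' 0 (bilin0r _ _); by rewrite !orth_map0.
pose J : set R := [set c | forall a, D (orth_map u ((a * c) *: v))].
suff JT : forall x, J x by have := JT 1 1; rewrite mulr1 scale1r.
have uZv c : B u (c *: v) = 0 by rewrite bilinZr uv mulr0.
apply: ideal_local.
  split=> [a|x y Jx Jy a|b x Jx a] /=; first by rewrite mulr0 scale0r.
  - rewrite mulrDr scalerDl; exact: (orth_D_add uu (uZv _) (uZv _) (Jx a) (Jy a)).
  - by rewrite mulrA; exact: Jx.
move=> I maxI; have [s [g [i0 [nIs [gB gC gt gf gP]]]]] := frame_local maxI.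
have gg i b : good (g i b).
  have [->|ni] := eqVneq i i0.
    case: b; rewrite ?gt ?gf; last exact: good_f.
    exact/goodZ/good_e.
  by apply: good_perp; [exact: gP|rewrite gB eqxx; case: (b)].
(* The contraction of the bivector [x ^ y] with [<u, .>]. For [x = w0] and [y = v] it is [v], so it
   suffices to treat pairs of frame vectors. *)
pose koszul x y := B u x *: y - B u y *: x.
pose W w := B u w = 0 /\ forall r, D (orth_map u (r *: w)).
have WD w w' : W w -> W w' -> W (w + w').
  move=> [uw Dw] [uw' Dw']; split=> [|r]; first by rewrite bilinDr uw uw' addr0.
  by rewrite scalerDr; apply: orth_D_add; rewrite // bilinZr ?uw ?uw' mulr0.
have WZ c w : W w -> W (c *: w).
  move=> [uw Dw]; split=> [|r]; first by rewrite bilinZr uw mulr0.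
  by rewrite scalerA.
have W0 : W 0 by rewrite -(scale0r 0); apply: WZ; split=> [|r]; rewrite ?scaler0 ?bilinE.
(* The contraction [w] is then isotropic, and orthogonal to [u] and to the plane [k]. So [good_pair]
   applies with root [w] and the pair [g k], and exchanging the arguments restores the root [u]. *)
have Wisotropic k x y : B x x = 0 -> B y y = 0 -> B x y = 0 ->
    (forall b, B x (g k b) = 0) -> (forall b, B y (g k b) = 0) -> W (s ^+ 2 *: koszul x y).
  move=> xx yy xy xk yk.
  have [w wE] : exists w, w = koszul x y by eexists.
  have ww : B w w = 0 by rewrite wE /koszul !bilinE xx yy (symB y x) xy; ring.
  have uw : B u w = 0 by rewrite wE /koszul !bilinE; ring.
  have wk b : B w (g k b) = 0 by rewrite wE /koszul !bilinE xk yk; ring.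
  rewrite -wE; split=> [|r]; first by rewrite bilinZr uw mulr0.
  have wNu : B w (- (r *: u)) = 0 by rewrite !bilinE symB uw; ring.
  have := good_pair (gg k true) (gg k false) ww (wk true) (wk false) wNu.
  rewrite gB eqxx /= -(orth_mapZ (s ^+ 2) w) => {}wNu.
  have -> : orth_map u (r *: (s ^+ 2 *: w)) = orth_map (s ^+ 2 *: w) (- (r *: u)).
    by rewrite -orth_mapZ orth_map_swap // !bilinE ?uu ?ww !mulr0.
  exact: wNu.
have koszulE x y x' y' : koszul (x + x') (y + y') =
    koszul x y + koszul x y' + koszul x' y + koszul x' y'.
  by rewrite /koszul !bilinE; module.
have gn i j b c : i != j -> B (g i b) (g j c) = 0 by move=> /negPf ij; rewrite gB ij.
have gi i b : B (g i b) (g i b) = 0 by rewrite gB; case: b; rewrite andbF.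
have Wdistinct i j b c : i != j -> W (s ^+ 2 *: koszul (g i b) (g j c)).
  move=> ij; have [k ki kj] := third_index i j.
  by apply: (Wisotropic k) => // *; apply: gn; rewrite // eq_sym.
(* [e_i ^ f_i] is half the sum of [(e_i + e_j) ^ (f_i - f_j)] and
   [(e_i + f_j) ^ (f_i - e_j)], up to terms [x ^ y] with [x] and [y] in
   different planes. *)
have Wsame i b : W (s ^+ 2 *: koszul (g i b) (g i (~~ b))).
  have [j ji _] := third_index i i; have [k ki kj] := third_index i j.
  have ij : i != j by rewrite eq_sym.
  have Wd d : W (s ^+ 2 *: koszul (g i b + g j d) (g i (~~ b) - g j (~~ d))).
    have gij c c' : B (g i c) (g j c') = 0 by exact: gn.
    have gji c c' : B (g j c) (g i c') = 0 by exact: gn.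
    apply: (Wisotropic k); rewrite ?bilinE ?gi ?gij ?gji.
    - by ring.
    - by ring.
    - by rewrite !gB !eqxx; case: (b); case: (d); rewrite /=; ring.
    - by move=> c; rewrite !bilinE !gn ?addr0 // eq_sym.
    - by move=> c; rewrite !bilinE !gn ?oppr0 ?addr0 // eq_sym.
  have -> : s ^+ 2 *: koszul (g i b) (g i (~~ b)) =
      h *: (s ^+ 2 *: koszul (g i b + g j true) (g i (~~ b) - g j false) +
            s ^+ 2 *: koszul (g i b + g j false) (g i (~~ b) - g j true)) +
      h *: (s ^+ 2 *: koszul (g i b) (g j false) + s ^+ 2 *: koszul (g i b) (g j true)) +
      (- h) *: (s ^+ 2 *: koszul (g j true) (g i (~~ b)) +
            s ^+ 2 *: koszul (g j false) (g i (~~ b))).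
    rewrite -[LHS]scale1r -[in LHS]hE /koszul !bilinE.
    by module.
  apply: (WD _ _ (WD _ _ (WZ _ _ _) (WZ _ _ _)) (WZ _ _ _)).
  - by apply: WD; exact: Wd.
  - by apply: WD; exact: Wdistinct.
  - by apply: WD; exact: Wdistinct.
have Wall i j b c : W (s ^+ 2 *: koszul (g i b) (g j c)).
  have [<-|ij] := eqVneq i j; last exact: Wdistinct.
  have [<-|bc] := eqVneq b c.
    by have -> : koszul (g i b) (g i b) = 0; [rewrite /koszul subrr|rewrite scaler0].
  by have -> : c = ~~ b by case: (b) (c) bc => [] [].
(* One [s ^+ 2] comes from [good_pair], and one [s] from each of the expansions of [w0] and [v] in
   the frame. *)
exists (s ^+ 4); last first.
  have [_ _ IP] := maximal_prime maxI.
  by rewrite !exprS expr0 mulr1; do 3!(case/IP => //).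
have koszul_suml (F : 'I_m -> M) y : koszul (\sum_i F i) y = \sum_i koszul (F i) y.
  apply: (big_morph (koszul^~ y)) => [x x'|]; rewrite /koszul !bilinE; module.
have koszul_sumlb (F : bool -> M) y : koszul (\sum_i F i) y = \sum_i koszul (F i) y.
  apply: (big_morph (koszul^~ y)) => [x x'|]; rewrite /koszul !bilinE; module.
have koszulC x y : koszul x y = - koszul y x by rewrite /koszul; module.
have koszulZ c x y : koszul (c *: x) y = c *: koszul x y.
  by rewrite /koszul !bilinE; module.
have Wsum (T : finType) (F : T -> M) : (forall j, W (F j)) -> W (\sum_j F j).
  by move=> WF; apply: big_ind.
have Wspan (N : R) y : (forall i b, W (N *: koszul (g i b) y)) ->
    forall x, W ((N * s) *: koszul x y).
  move=> Wg x; rewrite -scalerA -koszulZ gC koszul_suml scaler_sumr; apply: (Wsum) => i.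
  rewrite koszul_sumlb scaler_sumr; apply: (Wsum) => b.
  by rewrite koszulZ scalerA mulrC -scalerA; exact: WZ.
have [_ Wv] : W ((s ^+ 2 * s * s) *: koszul w0 v).
  apply: (Wspan) => i b; rewrite koszulC -scaleN1r scalerA mulrC -scalerA; apply: WZ.
  by apply: (Wspan) => j c.
move=> a; have := Wv a; rewrite /koszul uv uw0 scale0r subr0 scale1r scalerA.
by have -> : a * (s ^+ 2 * s * s) = a * s ^+ 4 by ring.
Qed.
End OrthogonalMaps.

(** * Linear transvections *)

(* The transvection [x + phi(x) q] of [U + R], where [q = (p, a)] and
   [phi = (psi, c)] lies in [V + R] and [V] is paired with [U] by [pair]. The
   hypotheses on the set [D] of transvections are invariant under exchanging
   [U] and [V], so that unimodular [q] and unimodular [phi] are treated by the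
   same argument. *)
Section LinearTransvections.
Variables (R : comPzRingType) (U V : lmodType R) (pair : U -> V -> R).
Hypothesis pairDl : forall a p p' psi, pair (a *: p + p') psi = a * pair p psi + pair p' psi.
Hypothesis pairDr : forall a p psi psi', pair p (a *: psi + psi') = a * pair p psi + pair p psi'.
Variable D : U -> R -> V -> R -> Prop.
Hypothesis D_addr : forall p a psi c psi' c',
  pair p psi + a * c = 0 -> pair p psi' + a * c' = 0 ->
  D p a psi c -> D p a psi' c' -> D p a (psi + psi') (c + c').
Hypothesis D_addl : forall p a p' a' psi c,
  pair p psi + a * c = 0 -> pair p' psi + a' * c = 0 ->
  D p a psi c -> D p' a' psi c -> D (p + p') (a + a') psi c.
Hypothesis D_scale : forall r p a psi c,
  D (r *: p) (r * a) psi c <-> D p a (r *: psi) (r * c).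
Hypothesis D_commutator : forall p a chi k y b psi c,
  pair p chi + a * k = 0 -> pair p psi + a * c = 0 -> pair y psi + b * c = 0 ->
  D p a chi k -> D y b psi c ->
  D p a ((pair y chi + b * k) *: psi) ((pair y chi + b * k) * c).
Hypothesis D_elemr : forall p a psi, pair p psi = 0 -> D p a psi 0.
Hypothesis D_eleml : forall p psi c, pair p psi = 0 -> D p 0 psi c.

Let pairZl a p psi : pair (a *: p) psi = a * pair p psi.
Proof.
have p0 : pair 0 psi = 0.
  by have := pairDl (-1) 0 0 psi; rewrite scaler0 add0r mulN1r addNr.
by rewrite -[_ *: _]addr0 pairDl p0 addr0.
Qed.
Let pairZr a p psi : pair p (a *: psi) = a * pair p psi.
Proof.
have p0 : pair p 0 = 0.
  by have := pairDr (-1) p 0 0; rewrite scaler0 add0r mulN1r addNr.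
by rewrite -[_ *: _]addr0 pairDr p0 addr0.
Qed.
Let pairAl p p' psi : pair (p + p') psi = pair p psi + pair p' psi.
Proof. by rewrite -[p]scale1r pairDl mul1r scale1r. Qed.
Let pairAr p psi psi' : pair p (psi + psi') = pair p psi + pair p psi'.
Proof. by rewrite -[psi]scale1r pairDr mul1r scale1r. Qed.
Let pairNl p psi : pair (- p) psi = - pair p psi.
Proof. by rewrite -scaleN1r pairZl mulN1r. Qed.
Let pairNr p psi : pair p (- psi) = - pair p psi.
Proof. by rewrite -scaleN1r pairZr mulN1r. Qed.
Let pairE := (pairAl, pairAr, pairZl, pairZr, pairNl, pairNr).

(** Contracting [psi] wedge the last coordinate with [q] gives a functional vanishing on
    [q = (p, a)]. Write [t q] as a multiple of [(e, 0)] plus [(y, t a)], where [chi] kills [y]. The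
    first part is elementary; the second is a commutator of a map with vector [(y, t a)] and
    functional [chi] and a map with vector [(e, 0)], which contributes the other [t]. *)
Lemma lin_D_koszul_dir p a psi e chi r : pair e psi = 0 ->
  D p a ((pair e chi ^+ 2 * r * a) *: psi) (- (pair e chi ^+ 2 * r * pair p psi)).
Proof.
move=> epsi; set t := pair e chi.
have [y yE] : exists y, y = t *: p - pair p chi *: e by eexists.
have ychi : pair y chi = 0 by rewrite yE !pairE -/t; ring.
have ypsi : pair y psi = t * pair p psi by rewrite yE !pairE epsi; ring.
have -> : (t ^+ 2 * r * a) *: psi = t *: ((t * r * a) *: psi) by module.
have -> : - (t ^+ 2 * r * pair p psi) = t * (- (t * r * pair p psi)) by ring.
apply/D_scale; set c := - (t * r * pair p psi).
have -> : t *: p = pair p chi *: e + y by rewrite yE; module.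
have -> : t * a = 0 + t * a by ring.
apply: D_addl.
- by rewrite !pairE epsi; ring.
- by rewrite !pairE ypsi /c; ring.
- by apply: D_eleml; rewrite !pairE epsi; ring.
have -> : (t * r * a) *: psi = (pair e chi + 0 * 0) *: ((r * a) *: psi).
  by rewrite -/t; module.
have -> : c = (pair e chi + 0 * 0) * (- (r * pair p psi)) by rewrite -/t /c; ring.
apply: D_commutator.
- by rewrite ychi; ring.
- by rewrite !pairE ypsi; ring.
- by rewrite !pairE epsi; ring.
- exact: D_elemr.
- by apply: D_eleml; rewrite !pairE epsi; ring.
Qed.

Hypothesis rank2_local : forall I, maximal_ideal I ->
  exists t (e1 e2 : U) (chi1 chi2 : V), [/\ ~ I t, pair e1 chi1 = t, pair e2 chi2 = t,
    pair e1 chi2 = 0 & pair e2 chi1 = 0].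

Lemma lin_D_koszul p a psi : D p a (a *: psi) (- pair p psi).
Proof.
pose J : set R := [set c | forall r, D p a ((c * r * a) *: psi) (- (c * r * pair p psi))].
suff JT : forall x, J x by have := JT 1 1; rewrite !mul1r.
have pair0 c : pair p ((c * a) *: psi) + a * (- (c * pair p psi)) = 0.
  by rewrite !pairE; ring.
apply: ideal_local.
  split=> [r|x y Jx Jy r|b x Jx r] /=.
  - by rewrite !mul0r scale0r oppr0; apply: D_elemr; rewrite -(scale0r 0) pairE mul0r.
  - have -> : ((x + y) * r * a) *: psi = (x * r * a) *: psi + (y * r * a) *: psi.
      by module.
    have -> : - ((x + y) * r * pair p psi) = - (x * r * pair p psi) - y * r * pair p psi.
      by ring.
    exact: (D_addr (pair0 _) (pair0 _) (Jx r) (Jy r)).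
  - by rewrite [b * x]mulrC -(mulrA x); exact: Jx.
move=> I maxI; have [t [e1 [e2 [chi1 [chi2 [nIt e1chi1 e2chi2 e1chi2 e2chi1]]]]]] :=
  rank2_local maxI.
(* Each of [chi1], [chi2] and [eta] is killed by [e1] or [e2], which has a functional pairing with
   it to [t]: this is why two dual pairs are required. The cube is [t ^+ 2] from each direction
   times the [t] in front of [psi]. *)
have [eta etaE] : exists v, v = t *: psi - pair e1 psi *: chi1 - pair e2 psi *: chi2.
  by eexists.
have e1eta : pair e1 eta = 0 by rewrite etaE !pairE e1chi1 e1chi2; ring.
have D1 r := @lin_D_koszul_dir p a chi1 e2 chi2 r e2chi1.
have D2 r := @lin_D_koszul_dir p a chi2 e1 chi1 r e1chi2.
have D3 r := @lin_D_koszul_dir p a eta e1 chi1 r e1eta.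
rewrite !e1chi1 in D2 D3; rewrite !e2chi2 in D1.
have pair0' (c : R) chi : pair p ((c * a) *: chi) + a * (- (c * pair p chi)) = 0.
  by rewrite !pairE; ring.
exists (t ^+ 3) => [r|]; last first.
  have [_ _ IP] := maximal_prime maxI.
  by rewrite !exprS expr0 mulr1; do 2!(case/IP => //).
have -> : (t ^+ 3 * r * a) *: psi = (t ^+ 2 * r * a) *: eta +
    ((t ^+ 2 * (r * pair e1 psi) * a) *: chi1 + (t ^+ 2 * (r * pair e2 psi) * a) *: chi2).
  by rewrite etaE; module.
have -> : - (t ^+ 3 * r * pair p psi) = - (t ^+ 2 * r * pair p eta) +
    (- (t ^+ 2 * (r * pair e1 psi) * pair p chi1) +
     - (t ^+ 2 * (r * pair e2 psi) * pair p chi2)).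
  by rewrite etaE !pairE; ring.
apply: D_addr; [exact: pair0'|by rewrite !pairE; ring|exact: D3|].
by apply: D_addr; [exact: pair0'|exact: pair0'|exact: D1|exact: D2].
Qed.

(* With [lambda = (mu, d)] and [phi = (psi, c)], the equality
   [phi = lambda(q) phi - phi(q) lambda] writes [phi] as the contraction of
   [lambda ^ phi] with [q]. *)
Lemma lin_D_unimodular p a psi c mu d :
  pair p mu + a * d = 1 -> pair p psi + a * c = 0 -> D p a psi c.
Proof.
move=> pmu ppsi.
have [psi' psi'E] : exists v, v = d *: psi - c *: mu by eexists.
have ppsiE : pair p psi = - (a * c) by apply/eqP; rewrite -addr_eq0 ppsi.
have pmuE : pair p mu = 1 - a * d by rewrite -pmu addrK.
(* Splits [lambda ^ phi] into its part on the first summand, whose contraction vanishes on [p], and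
   its mixed part, to which [lin_D_koszul] applies with [psi']. *)
have -> : psi = (pair p mu *: psi - pair p psi *: mu) + a *: psi'.
  by rewrite psi'E pmuE ppsiE; module.
have -> : c = 0 - pair p psi' by rewrite psi'E !pairE ppsiE pmuE; ring.
have p0 : pair p (pair p mu *: psi - pair p psi *: mu) = 0.
  by rewrite !pairE; ring.
apply: D_addr; [by rewrite p0; ring|by rewrite !pairE; ring|exact: D_elemr|].
exact: lin_D_koszul.
Qed.
End LinearTransvections.

(** * Localization and hyperbolic frames *)

Section LocalizationMap.
Variables (R : comPzRingType) (S : mulrClosed R).

Definition to_locring (a : R) : locring S := ringfrac a (denom1 S).

Lemma to_locring1 : to_locring 1 = 1. Proof. by []. Qed.

Lemma to_locringM a b : to_locring (a * b) = to_locring a * to_locring b.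
Proof. by rewrite [RHS]mul_frac; apply: ringfrac_congr => /=; ring. Qed.

Lemma to_locringN a : to_locring (- a) = - to_locring a.
Proof. exact/esym/(@opp_frac R S R^o). Qed.

Lemma to_locringD a b : to_locring (a + b) = to_locring a + to_locring b.
Proof. by rewrite [RHS]add_ringfrac; apply: ringfrac_congr => /=; ring. Qed.

Lemma to_locring_sum (J : finType) (F : J -> R) :
  to_locring (\sum_j F j) = \sum_j to_locring (F j).
Proof. exact: (big_morph _ to_locringD). Qed.

Lemma fin_multiple (J : finType) (P : J -> R -> Prop) :
  (forall j, exists2 t, t \in S & P j t) -> (forall j t a, P j t -> P j (a * t)) ->
  exists2 t, t \in S & forall j, P j t.
Proof.
move=> PS PM.
have /choice[t tP] j : exists t, t \in S /\ P j t by have [t] := PS j; exists t.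
exists (\prod_j t j) => [|j]; first by apply: rpred_prod => j _; have [] := tP j.
by rewrite (bigD1 j) //= mulrC; apply: PM; have [] := tP j.
Qed.

Section Module.
Variable M : lmodType R.

Definition to_locmod (x : M) : locmod S M := Defs.frac x (denom1 S).

Lemma to_locmodD x y : to_locmod (x + y) = to_locmod x + to_locmod y.
Proof. by rewrite [RHS]add_frac; apply: frac_congr; rewrite /= mulr1 !scale1r. Qed.

Lemma to_locmodZ a x : to_locmod (a *: x) = to_locring a *: to_locmod x.
Proof. by rewrite [RHS]scale_frac; apply: frac_congr; rewrite /= mulr1. Qed.

Lemma to_locmod_sum (J : finType) (F : J -> M) :
  to_locmod (\sum_j F j) = \sum_j to_locmod (F j).
Proof. exact: (big_morph _ to_locmodD). Qed.

Lemma to_locmod_eq x y : to_locmod x = to_locmod y -> exists2 u, u \in S & u *: x = u *: y.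
Proof. by case/fracP => u uS; rewrite /= !mulr1; exists u. Qed.

Lemma to_locmod_eqs (J : finType) (x y : J -> M) :
  (forall j, to_locmod (x j) = to_locmod (y j)) ->
  exists2 u, u \in S & forall j, u *: x j = u *: y j.
Proof.
move=> xy; apply: fin_multiple => [j|j u a e]; first exact: to_locmod_eq.
by rewrite -!scalerA e.
Qed.

Lemma common_denom (J : finType) (X : J -> locmod S M) :
  exists2 t, t \in S & exists x : J -> M, forall j, to_locring t *: X j = to_locmod (x j).
Proof.
have [|j t a [x e]|t tS tP] := @fin_multiple J
    (fun j t => exists x, to_locring t *: X j = to_locmod x).
- move=> j; case: (X j) / fracW => x [s sS]; exists s => //; exists x.
  by rewrite [LHS]scale_frac; apply: frac_congr; rewrite /= mul1r scale1r.
- by exists (a *: x); rewrite to_locmodZ to_locringM -scalerA e.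
- by exists t => //; have /choice[x xP] := tP; exists x.
Qed.

Lemma loc_form_to_locmod (B : bilin M) x y :
  loc_form S B (to_locmod x) (to_locmod y) = to_locring (B x y).
Proof. by rewrite [LHS]loc_formE; apply: ringfrac_congr => /=; ring. Qed.
End Module.

Lemma to_locring_eqs (J : finType) (x y : J -> R) :
  (forall j, to_locring (x j) = to_locring (y j)) ->
  exists2 u, u \in S & forall j, u * x j = u * y j.
Proof. exact: (@to_locmod_eqs R^o). Qed.
End LocalizationMap.

(* The vectors [g i true] and [g i false] form a hyperbolic basis, up to the
   scale [s], for a form with [B y x = eps * B x y]. *)
Definition hyperbolic_frame (R : comPzRingType) (M : lmodType R) (B : bilin M)
    (m : nat) (eps s : R) (g : 'I_m -> bool -> M) : Prop :=
  (forall i b j c, B (g i b) (g j c) =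
     if (i == j) && (b != c) then (if b then s else eps * s) else 0) /\
  (forall x, s *: x =
     \sum_i \sum_b ((if b then eps else 1) * B (g i (~~ b)) x) *: g i b).

(** * The standard hyperbolic frame and its descent from a localization *)

Section StandardFrame.
Variables (R : comPzRingType) (m : nat).

Fact coord_dual_subproof (i : 'I_m) :
  (fun x : 'rV[R]_m => x 0 i : R^o) \in @dual_pred R 'rV[R]_m.
Proof. by apply/asboolP => a x y; rewrite !mxE. Qed.
Definition coord_dual i : dual 'rV[R]_m := Dual (coord_dual_subproof i).

(** The covector carries the label [true]: its pairing with the vector, in this order, is [1] for
    both forms. *)
Definition standard_frame (i : 'I_m) (b : bool) : hyperbolic 'rV[R]_m :=
  if b then (0, coord_dual i) else (delta_mx 0 i, 0).

Lemma dual0 (M : lmodType R) (f : dual M) : f 0 = 0 :> R.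
Proof.
have := dual_scalar f (-1) 0 0.
by rewrite scaler0 addr0 mulN1r addNr.
Qed.

Lemma dual_sum (M : lmodType R) (f : dual M) (J : finType) (F : J -> M) :
  f (\sum_j F j) = \sum_j f (F j) :> R.
Proof.
apply: (big_morph (f : M -> R)) => [x y|]; last exact: dual0.
by have := dual_scalar f 1 x y; rewrite scale1r mul1r.
Qed.

Lemma dualZ (M : lmodType R) (f : dual M) a x : f (a *: x) = a * f x :> R.
Proof. by have := dual_scalar f a x 0; rewrite !addr0 dual0 addr0. Qed.

Lemma dual_fun_sum (M : lmodType R) (J : finType) (F : J -> dual M) x :
  (\sum_j F j) x = \sum_j F j x :> R.
Proof. exact: (big_morph (fun f : dual M => f x : R)). Qed.

Lemma standard_frame_span (x : hyperbolic 'rV[R]_m) :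
  x = \sum_i (x.2 (delta_mx 0 i) *: standard_frame i true +
              x.1 0 i *: standard_frame i false).
Proof.
case: x => x f /=.
have E (F : 'I_m -> hyperbolic 'rV[R]_m) :
    \sum_i F i = (\sum_i (F i).1, \sum_i (F i).2).
  by rewrite [LHS]surjective_pairing; congr (_, _); apply: big_morph.
rewrite E; congr (_, _) => /=.
  rewrite [LHS]row_sum_delta; apply: eq_bigr => i _.
  by rewrite scaler0 add0r.
apply/val_inj/funext => y /=.
rewrite [RHS]dual_fun_sum {1}[y]row_sum_delta dual_sum; apply: eq_bigr => i _.
rewrite scaler0 addr0 dualZ mulrC; exact: esym.
Qed.
End StandardFrame.

Section HyperbolicForms.
Variables (R : comPzRingType) (N : lmodType R).
Implicit Types (v : N) (f : dual N) (x : hyperbolic N).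

Let dual0E v : (0 : dual N) v = 0 :> R. Proof. by []. Qed.

Lemma orth_hyp_vec v x : orth_hyp_fun (v, 0) x = x.2 v.
Proof.
by case: x => x f; transitivity ((0 : dual N) x + f v : R); rewrite // dual0E add0r.
Qed.
Lemma orth_hyp_covec f x : orth_hyp_fun (0, f) x = f x.1.
Proof. by case: x => x g; transitivity (f x + g 0 : R); rewrite // dual0 addr0. Qed.
Lemma symp_hyp_vec v x : symp_hyp_fun (v, 0) x = - x.2 v.
Proof.
by case: x => x f; transitivity ((0 : dual N) x - f v : R); rewrite // dual0E sub0r.
Qed.
Lemma symp_hyp_covec f x : symp_hyp_fun (0, f) x = f x.1.
Proof. by case: x => x g; transitivity (f x - g 0 : R); rewrite // dual0 subr0. Qed.
End HyperbolicForms.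

Lemma standard_frame_orth (R : comPzRingType) m :
  hyperbolic_frame (orth_hyp 'rV[R]_m) 1 1 (@standard_frame R m).
Proof.
split=> [i b j c|x].
  case: b; case: c; rewrite /= ?orth_hyp_vec ?orth_hyp_covec /= ?andbF ?andbT.
  - by rewrite !mxE.
  - by rewrite !mxE eqxx; case: (i == j).
  - by rewrite !mxE eqxx eq_sym mulr1; case: (i == j).
  - by [].
rewrite scale1r {1}[x]standard_frame_span; apply: eq_bigr => i _.
by rewrite big_bool /= orth_hyp_vec orth_hyp_covec !mul1r.
Qed.

Lemma standard_frame_symp (R : comPzRingType) m :
  hyperbolic_frame (symp_hyp 'rV[R]_m) (-1) 1 (@standard_frame R m).
Proof.
split=> [i b j c|x].
  case: b; case: c; rewrite /= ?symp_hyp_vec ?symp_hyp_covec /= ?andbF ?andbT.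
  - by rewrite !mxE.
  - by rewrite !mxE eqxx; case: (i == j).
  - by rewrite !mxE eqxx eq_sym mulr1; case: (i == j); rewrite ?oppr0.
  - exact: oppr0.
rewrite scale1r {1}[x]standard_frame_span; apply: eq_bigr => i _.
by rewrite big_bool /= symp_hyp_vec symp_hyp_covec mul1r mulN1r opprK.
Qed.

Lemma isometric_frame (R : comPzRingType) (M N : lmodType R) (B : bilin M) (C : bilin N)
    m eps s (g : 'I_m -> bool -> N) :
  isometric B C -> hyperbolic_frame C eps s g ->
  exists g' : 'I_m -> bool -> M, hyperbolic_frame B eps s g'.
Proof.
case=> f [f' fK f'K] fB [gC gspan]; exists (fun i b => f' (g i b)); split.
  by move=> i b j c; rewrite -fB !f'K gC.
have fZ a x : f (a *: x) = a *: f x by exact: linearZ.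
have fsum (T : finType) (F : T -> M) : f (\sum_j F j) = \sum_j f (F j) by exact: raddf_sum.
move=> x; apply: (can_inj fK); rewrite fZ gspan fsum; apply: eq_bigr => i _.
by rewrite fsum; apply: eq_bigr => b _; rewrite fZ -fB !f'K.
Qed.

Definition spanned (R : comPzRingType) (M : lmodType R) (J : finType) (g : J -> M) : Prop :=
  forall x, exists c : J -> R, x = \sum_j c j *: g j.

(** After clearing denominators by [t], being a frame amounts to finitely many identities: the Gram
    matrix and the expansions of the generators. They hold up to factors [u1] and [u2] of [S], which
    are absorbed by rescaling the vectors. *)
Lemma descend_frame (R : comPzRingType) (S : mulrClosed R) (M : lmodType R) (B : bilin M)
    (J : finType) (gen : J -> M) m eps (G : 'I_m -> bool -> locmod S M) :
  spanned gen -> hyperbolic_frame (loc_form S B) (to_locring S eps) 1 G ->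
  exists2 s, s \in S & exists g : 'I_m -> bool -> M, hyperbolic_frame B eps s g.
Proof.
move=> genM [GB Gspan].
have [t tS [x' x'E]] := common_denom (fun ib : 'I_m * bool => G ib.1 ib.2).
pose x i b := x' (i, b); have xE i b : to_locring S t *: G i b = to_locmod S (x i b).
  exact: (x'E (i, b)).
have to0 : to_locring S 0 = 0 by [].
pose hyp (k : 'I_m * bool * ('I_m * bool)) : R :=
  if (k.1.1 == k.2.1) && (k.1.2 != k.2.2) then (if k.1.2 then 1 else eps) else 0.
have e1 (k : 'I_m * bool * ('I_m * bool)) :
    to_locring S (B (x k.1.1 k.1.2) (x k.2.1 k.2.2)) = to_locring S (t ^+ 2 * hyp k).
  case: k => [[i b] [j c]]; rewrite /hyp /=.
  rewrite -loc_form_to_locmod -!xE !bilinE GB to_locringM expr2 to_locringM.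
  case: ifP => _; last by rewrite to0; ring.
  by case: b; rewrite ?to_locring1; ring.
have e2 j : to_locmod S (t ^+ 2 *: gen j) = to_locmod S
    (\sum_i \sum_b ((if b then eps else 1) * B (x i (~~ b)) (gen j)) *: x i b).
  rewrite to_locmodZ expr2 to_locringM -scalerA -[to_locmod S (gen j)]scale1r.
  rewrite Gspan to_locmod_sum !scaler_sumr; apply: eq_bigr => i _.
  rewrite to_locmod_sum !scaler_sumr; apply: eq_bigr => b _.
  rewrite to_locmodZ to_locringM -loc_form_to_locmod -!xE bilinZl !scalerA.
  congr (_ *: _); case: b; rewrite ?to_locring1; ring.
have [u1 u1S u1E] := to_locring_eqs e1; have [u2 u2S u2E] := to_locmod_eqs e2.
exists ((u1 * u2) ^+ 2 * t ^+ 2); first by rewrite rpredM ?rpredX ?rpredM.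
exists (fun i b => (u1 * u2) *: x i b); split=> [i b j c|v].
  rewrite !bilinE.
  have -> : u1 * u2 * (u1 * u2 * B (x i b) (x j c)) =
    u1 * u2 ^+ 2 * (u1 * B (x i b) (x j c)) by ring.
  rewrite (u1E (i, b, (j, c))) /hyp /=.
  by case: (i == j); case: b; case: c => /=; ring.
have [c ->] := genM v.
have E j : ((u1 * u2) ^+ 2 * t ^+ 2) *: (c j *: gen j) = \sum_i \sum_b
    ((if b then eps else 1) * B ((u1 * u2) *: x i (~~ b)) (c j *: gen j)) *:
      ((u1 * u2) *: x i b).
  have -> : ((u1 * u2) ^+ 2 * t ^+ 2) *: (c j *: gen j) =
      (c j * u1 ^+ 2 * u2) *: (u2 *: (t ^+ 2 *: gen j)) by module.
  rewrite u2E scalerA scaler_sumr; apply: eq_bigr => i _.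
  rewrite scaler_sumr; apply: eq_bigr => b _.
  by rewrite !bilinE !scalerA; congr (_ *: _); ring.
rewrite scaler_sumr (eq_bigr _ (fun j _ => E j)).
rewrite exchange_big /=; apply: eq_bigr => i _; rewrite exchange_big /=.
apply: eq_bigr => b _.
by rewrite bilin_sumr mulr_sumr scaler_suml.
Qed.

(** * Adapting a frame to a given hyperbolic pair *)

Section FrameExchange.
Variables (R : comPzRingType) (M : lmodType R) (B : bilin M) (eps : R).
Hypothesis swapB : forall x y, B y x = eps * B x y.
Hypothesis eps2 : eps * eps = 1.
Variables (e f : M).
Hypotheses (ee0 : B e e = 0) (ef1 : B e f = 1).
Variables (m : nat) (s : R) (g : 'I_m -> bool -> M).
Hypothesis gframe : hyperbolic_frame B eps s g.
Variables (I : set R) (primeI : prime_ideal I) (nIs : ~ I s).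

(** Pairing the expansion of [s e] with [f] writes [s], up to the unit [eps], as a combination of
    the [B (g i b) e]; they cannot all lie in [I]. *)
Lemma frame_pivot : exists i b, ~ I (B (g i b) e).
Proof.
have [gB gspan] := gframe; have [[I0 ID IM] I1 _] := primeI.
apply: contrapT => nex; apply: nIs.
have Ie i b : I (B (g i b) e).
  by apply: contrapT => nI; apply: nex; exists i, b.
have -> : s = eps * (s * B f e).
  by rewrite (swapB e f) ef1; transitivity (s * (eps * eps)); [rewrite eps2 mulr1|ring].
apply: (IM); rewrite -bilinZr gspan bilin_sumr.
apply: (big_ind I I0 ID) => i _; rewrite bilin_sumr; apply: (big_ind I I0 ID) => b _.
by rewrite bilinZr mulrAC; apply: (IM).
Qed.

Variables (i0 : 'I_m) (b0 : bool).
Let y := g i0 b0.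
Let a := B y e.

(** A division-free Steinitz step with pivot [a]: the vector [z] is orthogonal to [e], and
    subtracting a multiple of [e] makes it orthogonal to [f] as well. *)
Definition exchange i b : M :=
  let z := a *: g i b - B (g i b) e *: y in z - B z f *: e.

Lemma exchange_perp i b : B e (exchange i b) = 0 /\ B f (exchange i b) = 0.
Proof.
rewrite /exchange; have [z zE] : exists z, z = a *: g i b - B (g i b) e *: y by eexists.
have ze : B z e = 0 by rewrite zE !bilinE /a; ring.
rewrite -zE !bilinE ee0 (swapB e f) ef1 (swapB z e) ze (swapB z f).
by split; ring.
Qed.

(** Nothing but the scale [a] affects the form, since [y] is isotropic and orthogonal to the other
    planes, and [e] is isotropic and orthogonal to [z]. *)
Lemma exchange_form i b j c : i != i0 -> j != i0 ->
  B (exchange i b) (exchange j c) = a ^+ 2 * B (g i b) (g j c).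
Proof.
move=> /negPf ni /negPf nj; have [gB _] := gframe.
have [z zE] : exists z, z = a *: g i b - B (g i b) e *: y by eexists.
have [w wE] : exists z, z = a *: g j c - B (g j c) e *: y by eexists.
have ze : B z e = 0 by rewrite zE !bilinE /a; ring.
have we : B w e = 0 by rewrite wE !bilinE /a; ring.
rewrite /exchange -zE -wE !bilinE ee0 (swapB w e) ze we.
have -> : B z w = a ^+ 2 * B (g i b) (g j c).
  rewrite zE wE !bilinE /y.
  have -> : B (g i b) (g i0 b0) = 0 by rewrite gB ni.
  have -> : B (g i0 b0) (g j c) = 0 by rewrite gB eq_sym nj.
  have -> : B (g i0 b0) (g i0 b0) = 0 by rewrite gB eqxx /=; case: (b0).
  by ring.
by ring.
Qed.
End FrameExchange.

Section OrthogonalExchange.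
Variables (R : comPzRingType) (M : lmodType R) (B : bilin M).
Hypothesis symB : symmetric_bilin B.
Variables (e f : M).
Hypotheses (ee0 : B e e = 0) (ff0 : B f f = 0) (ef1 : B e f = 1).
Variables (m : nat) (s : R) (g : 'I_m -> bool -> M).
Hypothesis gframe : hyperbolic_frame B 1 s g.
Variables (i0 : 'I_m) (b0 : bool).
Let a := B (g i0 b0) e.
Let k := a ^+ 2 * s.
Let z := exchange B e f g i0 b0.

(** As [a] and [s] need not be invertible, orthogonality only yields torsion. The hypotheses cancel
    all terms but [q y] in the expansion of [s (a d - <y, d> e)]; pairing with [e] and [f] then
    kills [q a] and [a <y, d> s]. *)
Lemma exchange_perp_torsion d : B e d = 0 -> B f d = 0 ->
  (forall i b, i != i0 -> B (z i b) d = 0) -> k *: d = 0.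
Proof.
move=> ed fd zd; have [gB gspan] := gframe.
have [y yE] : exists y, y = g i0 b0 by eexists.
have zdE i b : i != i0 -> a * B (g i b) d = B (g i b) e * B y d.
  move=> ni; have := zd i b ni.
  rewrite /z /exchange /= -/a -yE !bilinE ed mulr0 oppr0 addr0.
  by move/eqP; rewrite subr_eq0 => /eqP.
pose q := a * B (g i0 (~~ b0)) d - B y d * B (g i0 (~~ b0)) e.
have qE : (a * s) *: d - (B y d * s) *: e = q *: y.
  rewrite -2!scalerA !gspan !scaler_sumr -sumrB (bigD1 i0) //= [X in _ + X]big1 ?addr0.
    have sumb (F : bool -> M) : \sum_b F b = F b0 + F (~~ b0).
      by rewrite big_bool; case: (b0); rewrite // addrC.
    by rewrite !sumb negbK !if_same -yE /q /a -yE; module.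
  move=> i ni; rewrite !scaler_sumr -sumrB big1 // => b _.
  rewrite !scalerA -scalerBl if_same !mul1r (zdE i _ ni).
  by have -> : forall u v : R, u * v - v * u = 0; [move=> u v; ring|rewrite scale0r].
have qa : q * a = 0.
  have := congr1 (B^~ e) qE; rewrite /a -yE !bilinE ee0 (symB d e) ed => <-; ring.
have ayds : a * (B y d * s) = 0.
  have := congr1 (fun v => B (a *: v) f) qE.
  rewrite !bilinE ef1 (symB d f) fd.
  have -> : a * (q * B y f) = (q * a) * B y f by ring.
  rewrite qa mul0r => E.
  by rewrite -[RHS]oppr0 -E; ring.
have -> : k *: d = a *: ((a * s) *: d - (B y d * s) *: e) + (a * (B y d * s)) *: e.
  by rewrite /k; module.
by rewrite qE ayds scale0r addr0 scalerA mulrC qa scale0r.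
Qed.

Lemma exchange_frame : exists g', adapted_frame B e f (k ^+ 3) g' i0.
Proof.
have [gB gspan] := gframe.
have swapB x y : B y x = 1 * B x y by rewrite mul1r symB.
have zperp i b : B e (z i b) = 0 /\ B f (z i b) = 0 by exact: (exchange_perp swapB ee0 ef1).
have zB i b j c (ni : i != i0) (nj : j != i0) :
    B (z i b) (z j c) = if (i == j) && (b != c) then k else 0.
  rewrite (exchange_form swapB f ee0 gframe) // gB mul1r if_same.
  by case: ifP => _; rewrite ?mulr0.
have ztors := exchange_perp_torsion.
move: (z) zperp zB ztors => Z zperp zB ztors.
(* The vectors [Z i b] pair to [k] and span up to a defect [d] with [k d = 0]. Scaling them by [k]
   removes the defect and raises the scale to [k ^+ 3]. *)
pose g' i b := if i == i0 then (if b then k ^+ 3 *: e else f) else k *: Z i b.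
have fe1 : B f e = 1 by rewrite symB.
exists g'; split.
- move=> i b j c; rewrite /g'.
  have [ei|ni] := boolP (i == i0); have [ej|nj] := boolP (j == i0).
  + rewrite (eqP ei) (eqP ej) eqxx /=.
    by case: b; case: c; rewrite /= ?bilinE ?ee0 ?ff0 ?ef1 ?fe1; ring.
  + rewrite (eqP ei) eq_sym (negPf nj) /=; have [ez fz] := zperp j c.
    by case: b; rewrite !bilinE ?ez ?fz; ring.
  + rewrite (eqP ej) (negPf ni) /=; have [ez fz] := zperp i b.
    by case: c; rewrite !bilinE symB ?ez ?fz; ring.
  + by rewrite !bilinE zB //; case: ifP => _; ring.
- move=> v.
  pose w := \sum_(i | i != i0) \sum_b B (Z i (~~ b)) v *: Z i b.
  have [d dE] : exists d, d = k *: v - w - k *: (B f v *: e + B e v *: f) by eexists.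
  have Bw u : B u w = \sum_(i | i != i0) \sum_b B (Z i (~~ b)) v * B u (Z i b).
    rewrite /w (big_morph (B u) (fun p q => bilinDr B p q u) (bilin0r B u)).
    apply: eq_bigr => i _; rewrite bilin_sumr.
    by apply: eq_bigr => b _; rewrite bilinZr.
  have Bw0 u : (forall i b, B u (Z i b) = 0) -> B u w = 0.
    move=> uz; rewrite Bw big1 // => i _; rewrite big1 // => b _.
    by rewrite uz mulr0.
  have kd : k *: d = 0.
    apply: ztors.
    - rewrite dE !bilinE Bw0 ?ee0 ?ef1; first by ring.
      by move=> i b; case: (zperp i b).
    - rewrite dE !bilinE Bw0 ?ff0 ?fe1; first by ring.
      by move=> i b; case: (zperp i b).
    move=> i b ni; have [ez fz] := zperp i b.
    have wz : B (Z i b) w = B (Z i b) v * k.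
      rewrite Bw (bigD1 i) //= [X in _ + X]big1 ?addr0 => [|j /andP[nj ji]]; last first.
        by rewrite big1 // => c _; rewrite zB // eq_sym (negPf ji) mulr0.
      rewrite (bigD1 (~~ b)) //= [X in _ + X]big1 ?addr0 => [|c cb]; last first.
        rewrite zB // eqxx /=.
        by have -> : c = b; [case: (c) (b) cb => [] []|rewrite eqxx mulr0].
      by rewrite zB // eqxx negbK /=; case: (b).
    by rewrite dE !bilinE wz (symB _ e) (symB _ f) ez fz; ring.
  have -> : k ^+ 3 *: v = k ^+ 2 *: w + k ^+ 3 *: (B f v *: e + B e v *: f) + k *: (k *: d).
    by rewrite dE; module.
  rewrite kd scaler0 addr0 (bigD1 i0) //= [RHS]addrC; congr (_ + _).
    rewrite /w scaler_sumr; apply: eq_bigr => i ni; rewrite scaler_sumr.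
    by apply: eq_bigr => b _; rewrite /g' (negPf ni) !bilinE; module.
  by rewrite big_bool /= /g' eqxx /= !bilinE; module.
- by rewrite /g' eqxx.
- by rewrite /g' eqxx.
- move=> i b ni; rewrite /g' (negPf ni) /orth_perp !bilinE.
  by have [-> ->] := zperp i b; rewrite mulr0.
Qed.
End OrthogonalExchange.

(** * The three cases *)

Section Assembly.
Variables (R : comPzRingType).

Lemma not_compl (I : set R) (primeI : prime_ideal I) x : x \in compl primeI -> ~ I x.
Proof. exact: asboolW. Qed.

Lemma third_ord m (i j : 'I_m) : (3 <= m)%N -> exists2 k, k != i & k != j.
Proof.
move=> m3; have /subsetPn[k _] : ~~ ('I_m \subset pred2 i j).
  apply: contraL m3 => /subset_leq_card; rewrite card_ord card2 -ltnNge => mle.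
  by apply: leq_ltn_trans mle _; case: (i != j).
by rewrite !inE negb_or => /andP[]; exists k.
Qed.

Lemma laut_exists (M : lmodType R) (f g : M -> M) :
  linear f -> cancel f g -> cancel g f -> exists s : laut M, s = f :> (M -> M).
Proof.
move=> flin fK gK; have fP : f \in @laut_pred R M.
  by apply/asboolP; split=> //; exists g.
by exists (LAut fP).
Qed.

Lemma realizedP (M : lmodType R) (H : set (laut M)) (s : laut M) :
  realized H s -> H s.
Proof. by case=> t Ht /val_inj <-. Qed.

Lemma isometries_subgroup (M : lmodType R) (B : bilin M) : subgroup (isometries B).
Proof.
split=> [//|s t sB tB x y|s sB x y] /=; first by rewrite sB tB.
by rewrite -sB !(laut_inv_funP s).2.
Qed.

Lemma unimodular_laut (M : lmodType R) (g : laut M) x : unimodular x -> unimodular (g x).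
Proof.
move=> [f fx]; have fP : (fun y => f ((g^-1)%g y) : R^o) \in @dual_pred R M.
  by apply/asboolP => a y z; rewrite (laut_linear (g^-1)%g) dual_scalar.
by exists (Dual fP); rewrite /= (laut_inv_funP g).1.
Qed.

Lemma unimodular_dual_laut (M : lmodType R) (B : bilin M) (g : laut M) x :
  isometries B g -> unimodular_dual (to_dual B x) -> unimodular_dual (to_dual B (g x)).
Proof. by move=> gB [y xy]; exists (g y); rewrite /= gB. Qed.

Variables (P : lmodType R).
Hypothesis fgP : fin_gen P.

Lemma perp2_spanned : exists (J : finType) (gen : J -> perp2 P), spanned gen.
Proof.
have [n [g gspan]] := fgP.
exists ('I_n + bool)%type.
exists (fun j => match j with inl i => (g i, 0, 0) | inr true => (0, 1, 0)
                 | inr false => (0, 0, 1) end) => -[[p b] a].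
have [c ->] := gspan p.
exists (fun j => match j with inl i => c i | inr true => b | inr false => a end).
rewrite big_sumType /= big_bool /=.
have -> : \sum_i c i *: ((g i, 0, 0) : perp2 P) = (\sum_i c i *: g i, 0, 0).
  elim/big_rec2: _ => // i x y _ ->; congr (_, _, _).
    by transitivity (c i * 0 + 0 : R); [|rewrite mulr0 addr0].
  by transitivity (c i * 0 + 0 : R); [|rewrite mulr0 addr0].
congr (_, _, _).
- transitivity (\sum_i c i *: g i + (b *: 0 + a *: 0)); last by [].
  by rewrite !scaler0 !addr0.
- by transitivity (0 + (b * 1 + a * 0) : R); [ring|].
- by transitivity (0 + (b * 0 + a * 1) : R); [ring|].
Qed.

Definition plane_e : perp2 P := (0, 1, 0).
Definition plane_f : perp2 P := (0, 0, 1).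

(** * The symplectic group *)

Section Symplectic.
Variables (h : bilin P) (c2 : R) (m : nat).
Hypotheses (c2E : 2%:R * c2 = 1) (alth : alternating_bilin h) (m3 : (3 <= m)%N).
Hypothesis hyph : symp_locally_hyperbolic h m.
Let B := symp_perp2 h.
Let D := realized (sympET h).

Lemma symp_perp2_alternating : alternating_bilin B.
Proof. by move=> [[p b] a] /=; rewrite alth; ring. Qed.
Let altB := symp_perp2_alternating.

Lemma symp_plane_eE p b a : B plane_e (p, b, a) = a.
Proof. by rewrite /= bilin0l; ring. Qed.
Lemma symp_plane_fE p b a : B plane_f (p, b, a) = - b.
Proof. by rewrite /= bilin0l; ring. Qed.

Lemma symp_map_plane_e q p b a :
  symp_map B plane_e (q, 0, 0) 1 (p, b, a) = (p + a *: q, b - h p q + a, a).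
Proof.
have Bq : B (q, 0, 0) (p, b, a) = h q p by rewrite /=; ring.
rewrite /symp_map symp_plane_eE Bq mul1r (alternating_skew alth p q).
congr (_, _, _).
- transitivity (p + a *: q + - h p q *: 0 + a *: 0); first by [].
  by rewrite !scaler0 !addr0.
- by transitivity (b + a * 0 + - h p q * 1 + a * 1); [|ring].
- by transitivity (a + a * 0 + - h p q * 0 + a * 0); [|ring].
Qed.

(** The sign of [- q] compensates [<f, (p, b, a)> = - b]. *)
Lemma symp_map_plane_f q p b a :
  symp_map B plane_f (- q, 0, 0) 1 (p, b, a) = (p + b *: q, b, a + h p q - b).
Proof.
have Bq : B (- q, 0, 0) (p, b, a) = h p q.
  by rewrite /= (alternating_skew alth p (- q)) bilinNr; ring.
rewrite /symp_map symp_plane_fE Bq mul1r.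
congr (_, _, _).
- transitivity (p + (- b) *: - q + h p q *: 0 + (- b) *: 0); first by [].
  by rewrite !scaler0 !addr0 scalerN scaleNr opprK.
- by transitivity (b + - b * 0 + h p q * 0 + - b * 0); [|ring].
- by transitivity (a + - b * 0 + h p q * 1 + - b * 1); [|ring].
Qed.

Lemma symp_elementary_realized u w : B u w = 0 ->
  (forall s : laut (perp2 P), isometries B s -> s = symp_map B u w 1 :> (_ -> _) ->
     symp_elementary h s) -> D (symp_map B u w 1).
Proof.
move=> uw Es.
have Ku : cancel (symp_map B u (- w) (- 1)) (symp_map B u w 1).
  have := symp_mapK altB (u := u) (w := - w) (-1); rewrite !opprK; apply.
  by rewrite bilinNr uw oppr0.
have [s sE] := laut_exists (symp_map_linear B u w 1) (symp_mapK altB 1 uw) Ku.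
exists s => //; apply: sub_gen_smallest; apply: Es => // x y.
by rewrite sE; exact: symp_map_isometry.
Qed.

(** Descend the hyperbolic basis of the localization and exchange it against [e]. The two vectors of
    any plane other than [i0] become orthogonal to [e] and [f], and pair to [a ^+ 2 * s], which is
    outside [I]. *)
Lemma symp_perp_local I : maximal_ideal I ->
  exists2 z, symp_perp B plane_e plane_f z &
    exists2 z', symp_perp B plane_e plane_f z' & ~ I (B z z').
Proof.
move=> maxI; have [J [gen genP]] := perp2_spanned.
have [G GP] := isometric_frame (hyph maxI) (standard_frame_symp _ m).
have e1 : to_locring (compl (maximal_prime maxI)) (-1) = -1.
  by rewrite to_locringN.
rewrite -e1 in GP.
have [s /not_compl nIs [g gP]] := descend_frame genP GP.
have swapB x y : B y x = -1 * B x y by rewrite mulN1r (alternating_skew altB x).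
have N1 : (-1 : R) * -1 = 1 by ring.
have ef1 : B plane_e plane_f = 1 by rewrite /= bilin0l; ring.
have [i0 [b0 nIa]] := frame_pivot swapB N1 ef1 gP (maximal_prime maxI) nIs.
have [i ni _] := third_ord i0 i0 m3.
have zP b := exchange_perp swapB (altB plane_e) ef1 g i0 b0 i b.
exists (exchange B plane_e plane_f g i0 b0 i true); first exact: (zP true).
exists (exchange B plane_e plane_f g i0 b0 i false); first exact: (zP false).
rewrite (exchange_form swapB _ (altB plane_e) gP) // gP.1 eqxx /=.
have [_ _ IP] := maximal_prime maxI.
by rewrite expr2; case/IP => // /IP[].
Qed.

Lemma symp_D_transvection u v : B u v = 0 -> D (symp_map B u v 1).
Proof.
have sET : subgroup (sympET h) := generated_subgroup _.
apply: (symp_D_all altB (realized_comp sET) (realized_inv sET)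
          (e := plane_e) (f := plane_f)).
- by rewrite /= bilin0l; ring.
- exact: c2E.
- move=> [[q b] a] [eq fq]; move: eq fq; rewrite /= !bilin0l => eq fq.
  have {eq}-> : a = 0 by rewrite -[RHS]eq; ring.
  have {fq}-> : b = 0 by rewrite -[RHS]oppr0 -fq; ring.
  apply: symp_elementary_realized => [|s sB sE]; first by rewrite /= bilin0l; ring.
  by split=> //; exists q; left=> p b' a'; rewrite sE symp_map_plane_e.
- move=> [[q b] a] [eq fq]; move: eq fq; rewrite /= !bilin0l => eq fq.
  have {eq}-> : a = 0 by rewrite -[RHS]eq; ring.
  have {fq}-> : b = 0 by rewrite -[RHS]oppr0 -fq; ring.
  apply: symp_elementary_realized => [|s sB sE]; first by rewrite /= bilin0l; ring.
  by split=> //; exists (- q); right=> p b' a'; rewrite sE -symp_map_plane_f opprK.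
- exact: symp_perp_local.
Qed.

Lemma sympT_eq_sympET_normal : sympT h = sympET h /\ normal_subgroup (sympET h) (sympG h).
Proof.
have TE : sympT h = sympET h.
  apply: generated_eq => s [sB].
    case=> u [v [uv _ sE]]; apply: realizedP.
    have -> : s = symp_map B u v 1 :> (_ -> _).
      by apply/funext => x; rewrite sE /symp_map mul1r.
    exact: symp_D_transvection.
  case=> q qE; apply: sub_gen_smallest; split=> //.
  (* The functionals of [e] and [f] are unimodular because these vectors pair to [1] up to sign. *)
  case: qE => qE; [exists plane_e, (q, 0, 0)|exists plane_f, (- q, 0, 0)]; split.
  - by rewrite /= bilin0l; ring.
  - by right; exists plane_f; rewrite /= bilin0l; ring.
  - by move=> [[p b] a]; rewrite qE -symp_map_plane_e /symp_map mul1r.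
  - by rewrite /= bilin0l; ring.
  - by right; exists (- plane_e); rewrite /= bilin0l; ring.
  - by move=> [[p b] a]; rewrite qE -symp_map_plane_f /symp_map mul1r.
split=> //; rewrite -TE; apply: generated_normal.
- exact: isometries_subgroup.
- by move=> s [].
move=> g s gB [sB [u [v [uv uni sE]]]]; have [_ IM IV] := isometries_subgroup B.
split; first by apply: (IM); [exact: (IM)|exact: (IV)].
exists (g u), (g v); split; first by rewrite gB.
  by case: uni => uni; [left; exact: unimodular_laut|right; exact: unimodular_dual_laut].
move=> x; set y := (g^-1)%g x; have <- : g y = x by exact: (laut_inv_funP g).2.
have -> : (g * s * g^-1)%g (g y) = g (s y) by rewrite /= (laut_inv_funP g).1.
have -> : s y = symp_map B u v 1 y by rewrite sE /symp_map mul1r.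
by rewrite (symp_map_conj (B := B)) /symp_map ?mul1r //; exact: laut_linear.
Qed.
End Symplectic.
End Assembly.

(** * The orthogonal group *)

Section OrthogonalAssembly.
Variables (R : comPzRingType) (P : lmodType R).
Hypothesis fgP : fin_gen P.
Variables (h : bilin P) (c2 : R) (m : nat).
Hypotheses (c2E : 2%:R * c2 = 1) (symh : symmetric_bilin h) (nsh : nonsingular h).
Hypotheses (m3 : (3 <= m)%N) (hyph : orth_locally_hyperbolic h m).
Let B := orth_perp2 h.
Let D := realized (orthET h).
Let e := plane_e P.
Let f := plane_f P.

Lemma orth_perp2_symmetric : symmetric_bilin B.
Proof. by move=> [[p b] a] [[p' b'] a'] /=; rewrite symh; ring. Qed.
Let symB := orth_perp2_symmetric.

Lemma orth_plane_eE p b a : B e (p, b, a) = a.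
Proof. by rewrite /= bilin0l; ring. Qed.
Lemma orth_plane_fE p b a : B f (p, b, a) = b.
Proof. by rewrite /= bilin0l; ring. Qed.

Lemma orth_map_plane_e q p b a : h q q = 0 ->
  orth_map B c2 e (q, 0, 0) (p, b, a) = (p - a *: q, b + h p q, a).
Proof.
move=> qq; have Bq : B (q, 0, 0) (p, b, a) = h p q by rewrite /= symh; ring.
have BQ : B (q, 0, 0) (q, 0, 0) = 0 by rewrite /= qq; ring.
rewrite /orth_map orth_plane_eE Bq BQ mulr0 mul0r.
congr (_, _, _).
- transitivity (p - a *: q + h p q *: 0 - 0 *: 0); first by [].
  by rewrite !scaler0 subr0 addr0.
- by transitivity (b - a * 0 + h p q * 1 - 0 * 1); [|ring].
- by transitivity (a - a * 0 + h p q * 0 - 0 * 0); [|ring].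
Qed.

Lemma orth_map_plane_f q p b a : h q q = 0 ->
  orth_map B c2 f (q, 0, 0) (p, b, a) = (p - b *: q, b, a + h p q).
Proof.
move=> qq; have Bq : B (q, 0, 0) (p, b, a) = h p q by rewrite /= symh; ring.
have BQ : B (q, 0, 0) (q, 0, 0) = 0 by rewrite /= qq; ring.
rewrite /orth_map orth_plane_fE Bq BQ mulr0 mul0r.
congr (_, _, _).
- transitivity (p - b *: q + h p q *: 0 - 0 *: 0); first by [].
  by rewrite !scaler0 subr0 addr0.
- by transitivity (b - b * 0 + h p q * 0 - 0 * 0); [|ring].
- by transitivity (a - b * 0 + h p q * 1 - 0 * 1); [|ring].
Qed.

Lemma orth_elementary_realized u w : B u u = 0 -> B u w = 0 ->
  (forall s : laut (perp2 P), isometries B s -> s = orth_map B c2 u w :> (_ -> _) ->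
     orth_elementary h s) -> D (orth_map B c2 u w).
Proof.
move=> uu uw Es.
have Ku : cancel (orth_map B c2 u (- w)) (orth_map B c2 u w).
  have := orth_mapK symB c2E (u := u) (w := - w) uu; rewrite !opprK; apply.
  by rewrite bilinNr uw oppr0.
have [s sE] := laut_exists (orth_map_linear B c2 u w) (orth_mapK symB c2E uu uw) Ku.
exists s => //; apply: sub_gen_smallest; apply: Es => // x y.
by rewrite sE; exact: orth_map_isometry.
Qed.

Let ee : B e e = 0. Proof. exact: orth_plane_eE. Qed.
Let ff : B f f = 0. Proof. exact: orth_plane_fE. Qed.
Let ef : B e f = 1. Proof. exact: orth_plane_eE. Qed.

Lemma orth_frame_local I : maximal_ideal I ->
  exists s (g : 'I_m -> bool -> perp2 P) i0, ~ I s /\ adapted_frame B e f s g i0.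
Proof.
move=> maxI; have [J [gen genP]] := perp2_spanned fgP.
have [G GP] := isometric_frame (hyph maxI) (standard_frame_orth _ m).
have e1 : to_locring (compl (maximal_prime maxI)) 1 = 1 := to_locring1 _.
have {}GP : hyperbolic_frame (loc_form (compl (maximal_prime maxI)) B)
  (to_locring (compl (maximal_prime maxI)) 1) 1 G by rewrite e1.
have [s /not_compl nIs [g gP]] := descend_frame genP GP.
have swapB x y : B y x = 1 * B x y by rewrite mul1r symB.
have [i0 [b0 nIa]] := frame_pivot swapB (mulr1 1) ef gP (maximal_prime maxI) nIs.
have [g' g'P] := exchange_frame symB ee ff ef gP i0 b0.
exists ((B (g i0 b0) e ^+ 2 * s) ^+ 3), g', i0; split=> //.
have [_ _ IP] := maximal_prime maxI.
have nIk : ~ I (B (g i0 b0) e ^+ 2 * s) by rewrite expr2; case/IP => // /IP[].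
move: (_ * s) nIk => k nIk.
by rewrite !exprS expr0 mulr1; do 2!(case/IP => //).
Qed.

Lemma orth_D_transvection u v w0 : B u u = 0 -> B u v = 0 -> B u w0 = 1 ->
  D (orth_map B c2 u v).
Proof.
have sET : subgroup (orthET h) := generated_subgroup _.
apply: (orth_D_all symB c2E (realized_comp sET) (realized_inv sET) ee ff ef).
- move=> [[q b] a]; rewrite /orth_perp orth_plane_eE orth_plane_fE => -[-> ->] qq.
  have {}qq : h q q = 0 by rewrite -[RHS]qq /=; ring.
  apply: orth_elementary_realized => // [|s sB sE]; first exact: orth_plane_eE.
  by split=> //; exists q => //; left=> p b' a'; rewrite sE orth_map_plane_e.
- move=> [[q b] a]; rewrite /orth_perp orth_plane_eE orth_plane_fE => -[-> ->] qq.
  have {}qq : h q q = 0 by rewrite -[RHS]qq /=; ring.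
  apply: orth_elementary_realized => // [|s sB sE]; first exact: orth_plane_fE.
  by split=> //; exists q => //; right=> p b' a'; rewrite sE orth_map_plane_f.
- exact: orth_frame_local.
- by move=> i j; exact: third_ord.
Qed.

(** Nonsingularity of [h] represents the restriction of the functional to [P]. The values at [e] and
    [f] trade places because these vectors are dual to each other. *)
Lemma orth_unimodular_pairing v : unimodular v -> exists w, B v w = 1.
Proof.
move=> [phi phiv]; have [k _ kK] := nsh.
have rP : (fun p => phi (p, 0, 0) : R^o) \in @dual_pred R P.
  apply/asboolP => a x y; rewrite -(dual_scalar phi a (x, 0, 0) (y, 0, 0)).
  congr (dual_fun phi _); congr (_, _, _) => //.
    by transitivity (a * 0 + 0 : R); [ring|].
  by transitivity (a * 0 + 0 : R); [ring|].
pose r := Dual rP; exists (k r, (phi f : R), (phi e : R)).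
move: v phiv => [[p b] a] <-; rewrite /=.
have -> : h p (k r) = phi (p, 0, 0).
  by rewrite symh; exact: (congr1 (@^~ p) (congr1 (@dual_fun _ _) (kK r))).
have -> : ((p, b, a) : perp2 P) = b *: e + (a *: f + (p, 0, 0)).
  congr (_, _, _).
  - by transitivity (b *: 0 + (a *: 0 + p)); [rewrite !scaler0 !add0r|].
  - by transitivity (b * 1 + (a * 0 + 0) : R); [ring|].
  - by transitivity (b * 0 + (a * 1 + 0) : R); [ring|].
by rewrite dual_scalar dual_scalar; ring.
Qed.

Lemma orthT_eq_orthET_normal : orthT h = orthET h /\ normal_subgroup (orthET h) (orthG h).
Proof.
have mapE (s : laut (perp2 P)) u v : B v v = 0 ->
    (forall x, s x = x - B u x *: v + B v x *: u) -> s = orth_map B c2 u v :> (_ -> _).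
  move=> vv sE; apply/funext => x.
  by rewrite sE /orth_map vv mulr0 mul0r scale0r subr0.
have TE : orthT h = orthET h.
  apply: generated_eq => s [sB].
    case=> u [v [[uu vv uv] uni sE]]; apply: realizedP.
    rewrite /realized (mapE s u v) //.
    case: uni => [/orth_unimodular_pairing[w vw]|[w uw]]; last first.
      exact: (orth_D_transvection (w0 := w)).
    (* When it is [v] that is unimodular, it becomes the root. *)
    rewrite orth_map_swap //; apply: (orth_D_transvection (w0 := w)) => //.
    by rewrite bilinNr symB uv oppr0.
  case=> q qq qE; apply: sub_gen_smallest; split=> //.
  have BQ : B (q, 0, 0) (q, 0, 0) = 0 by rewrite /= qq; ring.
  have lin0 u x : orth_map B c2 u (q, 0, 0) x =
      x - B u x *: ((q, 0, 0) : perp2 P) + B (q, 0, 0) x *: u.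
    by rewrite /orth_map BQ mulr0 mul0r scale0r subr0.
  case: qE => qE; [exists e, (q, 0, 0)|exists f, (q, 0, 0)]; split.
  - by split; rewrite // orth_plane_eE.
  - by right; exists f.
  - by move=> [[p b] a]; rewrite qE -lin0 orth_map_plane_e.
  - by split; rewrite // orth_plane_fE.
  - by right; exists e; exact: orth_plane_fE.
  - by move=> [[p b] a]; rewrite qE -lin0 orth_map_plane_f.
split=> //; rewrite -TE; apply: generated_normal.
- exact: isometries_subgroup.
- by move=> s [].
move=> g s gB [sB [u [v [[uu vv uv] uni sE]]]]; have [_ IM IV] := isometries_subgroup B.
split; first by apply: (IM); [exact: (IM)|exact: (IV)].
exists (g u), (g v); split; first by rewrite !gB.
  by case: uni => uni; [left; exact: unimodular_laut|right; exact: unimodular_dual_laut].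
move=> x; set y := (g^-1)%g x; have <- : g y = x by exact: (laut_inv_funP g).2.
have -> : (g * s * g^-1)%g (g y) = g (s y) by rewrite /= (laut_inv_funP g).1.
rewrite (mapE s u v) // (orth_map_conj (B := B)) //; last exact: laut_linear.
by rewrite /orth_map !gB vv mulr0 mul0r scale0r subr0.
Qed.
End OrthogonalAssembly.

(** * Transvections of a module and their commutators *)

Section Transvections.
Variables (R : comPzRingType) (M : lmodType R).
Implicit Types (q : M) (phi chi : dual M).

Definition transvection q phi : M -> M := fun x => x + (phi x : R) *: q.

Lemma dualD phi x y : phi (x + y) = phi x + phi y :> R.
Proof. by have := dual_scalar phi 1 x y; rewrite scale1r mul1r. Qed.

Let dualE := (dualD, dualZ).

Lemma transvection_comp q phi chi : phi q = 0 -> chi q = 0 ->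
  transvection q phi \o transvection q chi = transvection q (phi + chi).
Proof.
move=> phiq chiq; apply/funext => x.
transitivity (x + (phi x + chi x : R) *: q); last by [].
by rewrite /transvection /= dualD dualZ phiq; module.
Qed.

Lemma transvection_compl q q' phi : phi q' = 0 ->
  transvection q phi \o transvection q' phi = transvection (q + q') phi.
Proof.
by move=> phiq; apply/funext => x; rewrite /transvection /= dualD dualZ phiq; module.
Qed.

Lemma transvectionZ a q phi : transvection (a *: q) phi = transvection q (a *: phi).
Proof.
apply/funext => x; transitivity (x + (a * phi x : R) *: q); last by [].
by rewrite /transvection; module.
Qed.

Lemma transvectionK q phi : phi q = 0 ->
  cancel (transvection q phi) (transvection (- q) phi).
Proof. by move=> phiq x; rewrite /transvection dualD dualZ phiq; module. Qed.

Lemma transvection_commutator q chi y phi : chi q = 0 -> phi q = 0 -> phi y = 0 ->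
  transvection q chi \o (transvection y phi \o
    (transvection (- q) chi \o transvection (- y) phi)) =
  transvection q ((chi y : R) *: phi).
Proof.
move=> chiq phiq phiy; apply/funext => x.
have chiN : chi (- q) = 0 :> R by rewrite -scaleN1r dualZ chiq mulr0.
have phiN : phi (- q) = 0 :> R by rewrite -scaleN1r dualZ phiq mulr0.
have phiNy : phi (- y) = 0 :> R by rewrite -scaleN1r dualZ phiy mulr0.
have chiNy : chi (- y) = - chi y :> R by rewrite -scaleN1r dualZ mulN1r.
transitivity (x + (chi y * phi x : R) *: q); last by [].
rewrite /transvection /= !dualE phiN phiNy chiN chiNy; module.
Qed.

Lemma transvection_linear q phi : linear (transvection q phi).
Proof. by move=> a x y; rewrite /transvection dualD dualZ; module. Qed.

Variable H : set (laut M).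
Hypothesis subgroupH : subgroup H.

Lemma realized_transvectionN q phi : phi q = 0 ->
  realized H (transvection q phi) -> realized H (transvection (- q) phi).
Proof. by move=> phiq Hq; apply: (realized_inv subgroupH Hq); exact: transvectionK. Qed.

Lemma realized_commutator q chi y phi : chi q = 0 -> phi q = 0 -> phi y = 0 ->
  realized H (transvection q chi) -> realized H (transvection y phi) ->
  realized H (transvection q ((chi y : R) *: phi)).
Proof.
move=> chiq phiq phiy Hq Hy; rewrite -transvection_commutator //.
by do !apply: realized_comp => //; exact: realized_transvectionN.
Qed.
End Transvections.

(** * The general linear group *)

Section LinearAssembly.
Variables (R : comPzRingType) (P : lmodType R).
Hypotheses (fgP : fin_gen P) (projP : projective P).

Fact dual_pair_subproof (psi : dual P) (c : R) :
  (fun x => psi x.1 + c * x.2 : R^o) \in @dual_pred R (lin_sum P).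
Proof.
apply/asboolP => a [p b] [p' b'].
transitivity (psi (a *: p + p') + c * (a * b + b') : R); first by [].
by rewrite dualD dualZ /=; ring.
Qed.
Definition dual_pair psi c : dual (lin_sum P) := Dual (dual_pair_subproof psi c).

Lemma dual_pairE psi c p a : dual_pair psi c (p, a) = psi p + c * a :> R.
Proof. by []. Qed.

Lemma dual_pair_surj (phi : dual (lin_sum P)) : exists psi c, phi = dual_pair psi c.
Proof.
have rP : (fun p => phi (p, 0) : R^o) \in @dual_pred R P.
  apply/asboolP => a x y; rewrite -(dual_scalar phi a (x, 0) (y, 0)).
  congr (dual_fun phi _); congr (_, _).
  by transitivity (a * 0 + 0 : R); [ring|].
exists (Dual rP), (phi (0, 1)); apply/val_inj/funext => -[p a] /=.
have -> : ((p, a) : lin_sum P) = a *: ((0, 1) : lin_sum P) + (p, 0).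
  congr (_, _); first by transitivity (a *: 0 + p); [rewrite scaler0 add0r|].
  by transitivity (a * 1 + 0 : R); [ring|].
by rewrite [LHS]dual_scalar addrC mulrC.
Qed.

Lemma dual_pairD psi c psi' c' :
  dual_pair psi c + dual_pair psi' c' = dual_pair (psi + psi') (c + c').
Proof.
apply/val_inj/funext => -[p a].
transitivity (psi p + c * a + (psi' p + c' * a) : R); first by [].
by transitivity (psi p + psi' p + (c + c') * a : R); [ring|].
Qed.

Lemma dual_pairZ r psi c : r *: dual_pair psi c = dual_pair (r *: psi) (r * c).
Proof.
apply/val_inj/funext => -[p a].
transitivity (r * (psi p + c * a) : R); first by [].
by transitivity (r * psi p + (r * c) * a : R); [ring|].
Qed.

Let H := linET P.
Let subgroupH : subgroup H. Proof. exact: generated_subgroup. Qed.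

Definition lin_D (p : P) (a : R) (psi : dual P) (c : R) : Prop :=
  realized H (transvection ((p, a) : lin_sum P) (dual_pair psi c)).

Lemma transvection_laut (M : lmodType R) q (phi : dual M) :
  phi q = 0 -> exists s : laut M, s = transvection q phi :> (M -> M).
Proof.
move=> phiq; apply: (laut_exists (transvection_linear q phi) (transvectionK phiq)).
move=> x; have := @transvectionK _ _ (- q) phi _ x; rewrite opprK; apply.
by rewrite -scaleN1r dualZ phiq mulr0.
Qed.

Lemma lin_D_elementaryl p : lin_D p 0 0 1.
Proof.
have [|s sE] := @transvection_laut (lin_sum P) (p, 0) (dual_pair 0 1).
  by transitivity (0 + 1 * 0 : R); [|ring].
exists s => //; apply: sub_gen_smallest; left; exists p => x a; rewrite sE.
congr (_, _).
- transitivity (x + (0 + 1 * a) *: p); first by [].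
  by rewrite add0r mul1r.
- by transitivity (a + (0 + 1 * a) * 0); [|ring].
Qed.

Lemma lin_D_elementaryr psi : lin_D 0 1 psi 0.
Proof.
have [|s sE] := @transvection_laut (lin_sum P) (0, 1) (dual_pair psi 0).
  by rewrite dual_pairE dual0; ring.
exists s => //; apply: sub_gen_smallest; right; exists psi => x a; rewrite sE.
congr (_, _).
- transitivity (x + (psi x + 0 * a) *: 0); first by [].
  by rewrite scaler0 addr0.
- by transitivity (a + (psi x + 0 * a) * 1); [|ring].
Qed.

Lemma lin_D_addr p a (psi : dual P) c (psi' : dual P) c' :
  psi p + a * c = 0 -> psi' p + a * c' = 0 ->
  lin_D p a psi c -> lin_D p a psi' c' -> lin_D p a (psi + psi') (c + c').
Proof.
rewrite /lin_D -dual_pairD => pp pp' Dc Dc'.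
rewrite -transvection_comp; first exact: realized_comp.
  by rewrite dual_pairE mulrC.
by rewrite dual_pairE mulrC.
Qed.

Lemma lin_D_addl p a p' a' (psi : dual P) c : psi p + a * c = 0 -> psi p' + a' * c = 0 ->
  lin_D p a psi c -> lin_D p' a' psi c -> lin_D (p + p') (a + a') psi c.
Proof.
rewrite /lin_D => pp pp' Dc Dc'.
have -> : ((p + p', a + a') : lin_sum P) = ((p, a) : lin_sum P) + (p', a') by [].
rewrite -transvection_compl; first exact: realized_comp.
by rewrite dual_pairE mulrC.
Qed.

Lemma lin_D_scale r p a psi c :
  lin_D (r *: p) (r * a) psi c <-> lin_D p a (r *: psi) (r * c).
Proof.
rewrite /lin_D -dual_pairZ -transvectionZ.
by have -> : ((r *: p, r * a) : lin_sum P) = r *: ((p, a) : lin_sum P) by [].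
Qed.

Lemma lin_D_commutator p a (chi : dual P) k y b (psi : dual P) c :
  chi p + a * k = 0 -> psi p + a * c = 0 -> psi y + b * c = 0 ->
  lin_D p a chi k -> lin_D y b psi c ->
  lin_D p a ((chi y + b * k : R) *: psi) ((chi y + b * k) * c).
Proof.
rewrite /lin_D -dual_pairZ => chip psip psiy.
have -> : chi y + b * k = dual_pair chi k (y, b) :> R by rewrite dual_pairE mulrC.
by apply: realized_commutator; rewrite // dual_pairE mulrC.
Qed.

(** The commutator of one elementary transvection of each kind. *)
Lemma lin_D_perp p (psi : dual P) : psi p = 0 -> lin_D p 0 psi 0.
Proof.
move=> psip.
have := @lin_D_commutator p 0 0 1 0 1 psi 0 _ _ _ (lin_D_elementaryl p) (lin_D_elementaryr psi).
have -> : (0 : dual P) 0 + 1 * 1 = 1 :> R by rewrite dual0; ring.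
rewrite scale1r mul1r; apply.
- by transitivity (0 + 0 * 1 : R); [|ring].
- by rewrite psip; ring.
- by rewrite dual0; ring.
Qed.

Lemma lin_D_elemr p a (psi : dual P) : psi p = 0 -> lin_D p a psi 0.
Proof.
move=> psip; rewrite -[p]addr0 -[a]add0r; apply: lin_D_addl.
- by rewrite psip; ring.
- by rewrite dual0; ring.
- exact: lin_D_perp.
have := lin_D_elementaryr (a *: psi); have := lin_D_scale a 0 1 psi 0.
by rewrite scaler0 mulr1 mulr0 => -[_ E] /E.
Qed.

Lemma lin_D_eleml p (psi : dual P) c : psi p = 0 -> lin_D p 0 psi c.
Proof.
move=> psip; rewrite -[psi]addr0 -[c]add0r; apply: lin_D_addr.
- by rewrite psip; ring.
- by transitivity (0 + 0 * c : R); [|ring].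
- exact: lin_D_perp.
have := lin_D_elementaryl (c *: p); have := lin_D_scale c p 0 0 1.
by rewrite scaler0 mulr1 mulr0 => -[E _] /E.
Qed.

(** The functionals are the coordinates of a section of the surjection from a free module onto
    [P]. *)
Lemma dual_basis : exists n (g : 'I_n -> P) (w : 'I_n -> dual P),
  forall p, p = \sum_i (w i p : R) *: g i.
Proof.
have [n [g gspan]] := fgP; exists n, g.
pose G (v : 'rV[R]_n) := \sum_i v 0 i *: g i.
have Glin : linear G.
  move=> a u v; rewrite /G scaler_sumr -big_split /=; apply: eq_bigr => i _.
  by rewrite !mxE scalerDl scalerA.
pose GL : {linear 'rV[R]_n -> P} := HB.pack G (GRing.isLinear.Build _ _ _ _ G Glin).
have Gsurj y : exists v, GL v = y.
  have [c ->] := gspan y; exists (\row_i c i).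
  by apply: eq_bigr => i _; rewrite mxE.
have [k kK] := projP (g := GL) idfun Gsurj.
have wP i : (fun p => k p 0 i : R^o) \in @dual_pred R P.
  by apply/asboolP => a x y; rewrite linearP !mxE.
by exists (fun i => Dual (wP i)) => p; rewrite -[LHS]kK.
Qed.

Variable n : nat.
Hypotheses (n3 : (3 <= n)%N) (rankP : constant_rank (lin_sum P) n).

(** A local basis of the sum and its coordinates yield vectors [x j] and functionals [(psi i, c i)],
    dual up to scale. With [c i0] outside [I], the combinations
    [c i0 (psi i, c i) - c i (psi i0, c i0)] vanish on [(0, 1)], hence live on [P]; the two
    remaining indices [i1] and [i2] give the dual pairs. *)
Lemma lin_rank2_local (I : set R) : maximal_ideal I ->
  exists (t : R) (e1 e2 : P) (chi1 chi2 : dual P), [/\ ~ I t, chi1 e1 = t, chi2 e2 = t,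
    chi2 e1 = 0 & chi1 e2 = 0].
Proof.
move=> maxI; set primeI := maximal_prime maxI.
have [_ I1 IP] := primeI; have [[I0 ID IM] _ _] := primeI.
pose S := compl primeI.
have [F [F' FK F'K]] := rankP primeI.
have FD x y : F (x + y) = F x + F y by exact: raddfD.
have FZ b x : F (b *: x) = b *: F x by exact: linearZ.
have Fsum (T : finType) (G : T -> locmod S (lin_sum P)) : F (\sum_j G j) = \sum_j F (G j).
  exact: raddf_sum.
have [d [g [w gw]]] := dual_basis.
pose e : lin_sum P := (0, 1).
have [t tS [x xE]] := @common_denom R S (lin_sum P) 'I_n (fun i => F' (delta_mx 0 i)).
(* Numerators of the coordinates of the generators [(g k, 0)], and of [e] at index [None]. The dual
   basis [w] assembles the former into functionals on [P]. *)
have [t' t'S [A AE]] := @common_denom R S R^o ('I_n * option 'I_d)%type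
  (fun j => F (to_locmod S (if j.2 is Some k then (g k, 0) else e)) 0 j.1).
pose a i k : R := A (i, Some k); pose c i : R := A (i, None).
pose psi i : dual P := \sum_k a i k *: w k.
have psiE i p : psi i p = \sum_k a i k * w k p :> R by exact: dual_fun_sum.
have lin_sumE p b : ((p, b) : lin_sum P) =
    (\sum_k (w k p : R) *: ((g k, 0) : lin_sum P)) + b *: e.
  have -> : \sum_k (w k p : R) *: ((g k, 0) : lin_sum P) = (p, 0).
    rewrite [in RHS](gw p); elim/big_rec2: _ => // k y z _ ->; congr (_, _).
    by transitivity (w k p * 0 + 0 : R); [|ring].
  congr (_, _); first by transitivity (p + b *: 0); [rewrite scaler0 addr0|].
  by transitivity (0 + b * 1 : R); [ring|].
have AE1 i k : to_locring S t' * F (to_locmod S ((g k, 0) : lin_sum P)) 0 i =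
    to_locring S (a i k) := AE (i, Some k).
have AE0 i : to_locring S t' * F (to_locmod S e) 0 i = to_locring S (c i) := AE (i, None).
have lamE i (y : lin_sum P) :
    to_locring S t' * F (to_locmod S y) 0 i = to_locring S (psi i y.1 + c i * y.2).
  case: y => p b; rewrite [in LHS]lin_sumE to_locmodD to_locmodZ to_locmod_sum.
  rewrite FD FZ Fsum !mxE summxE mulrDr mulr_sumr psiE to_locringD to_locring_sum.
  congr (_ + _); last by rewrite mulrCA AE0 -to_locringM mulrC.
  apply: eq_bigr => k _.
  by rewrite to_locmodZ FZ mxE mulrCA AE1 -to_locringM mulrC.
have xE' j : to_locmod S (x j) = to_locring S t *: F' (delta_mx 0 j) by [].
have eq1 (k : 'I_n * 'I_n) : to_locring S (psi k.1 (x k.2).1 + c k.1 * (x k.2).2) =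
    to_locring S (t * t' * (k.1 == k.2)%:R).
  case: k => i j; rewrite -lamE xE' FZ F'K !mxE eqxx /= !to_locringM.
  case: (i == j); first by rewrite to_locring1 !mulr1 mulrC.
  have to0 : to_locring S false%:R = 0 by [].
  by rewrite to0 !mulr0.
have eq2 : to_locmod S ((t * t') *: e) = to_locmod S (\sum_i c i *: x i).
  apply: (can_inj FK); rewrite to_locmodZ FZ to_locmod_sum Fsum.
  rewrite [in LHS](row_sum_delta (F (to_locmod S e))) scaler_sumr.
  apply: eq_bigr => i _; rewrite to_locmodZ FZ xE' FZ F'K !scalerA -AE0 to_locringM.
  by congr (_ *: _); ring.
have [u uS uE] := to_locring_eqs eq1; have [v vS vE] := to_locmod_eq eq2.
have nI (b : R) : b \in S -> ~ I b by exact: not_compl.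
(* The last component of the expansion of [e] writes [v t t'], an element outside [I], as a
   combination of the [c i]. *)
have [i0 nIc] : exists i, ~ I (c i).
  apply: contrapT => nex; have {}nex i : I (c i).
    by apply: contrapT => nIc; apply: nex; exists i.
  have vE2 : v * (t * t') = \sum_i v * (c i * (x i).2).
    have := congr1 snd vE; rewrite -mulr_sumr => E.
    transitivity (v * (t * t' * 1)); first by ring.
    rewrite [LHS]E; congr (v * _).
    exact: (big_morph (fun y : lin_sum P => y.2)).
  apply: (nI (v * (t * t'))); first by rewrite !rpredM.
  rewrite vE2; apply: (big_ind I I0 ID) => i _.
  have -> : v * (c i * (x i).2) = v * (x i).2 * c i by ring.
  exact: IM.
have [i1 ni1 _] := third_ord i0 i0 n3; have [i2 ni2 ni21] := third_ord i0 i1 n3.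
pose s := u * (t * t').
have uE' i j : u * psi i (x j).1 = (if i == j then s else 0) - u * c i * (x j).2.
  have := uE (i, j); rewrite /= mulrDr => /eqP; rewrite eq_sym -subr_eq => /eqP <-.
  by rewrite /s; case: (i == j); rewrite ?mulr1 ?mulr0; ring.
exists (u * c i0 * s), (x i1).1, (x i2).1.
exists ((u * c i0) *: (u *: psi i1) - (u * c i1) *: (u *: psi i0)).
exists ((u * c i0) *: (u *: psi i2) - (u * c i2) *: (u *: psi i0)).
have evE b b' (phi chi : dual P) p :
    (b *: (u *: phi) - b' *: (u *: chi)) p = b * (u * phi p) - b' * (u * chi p) :> R.
  by [].
split.
- by case/IP; [case/IP; [exact: nI|]|apply: nI; rewrite !rpredM].
- by rewrite evE !uE' eqxx eq_sym (negPf ni1); ring.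
- by rewrite evE !uE' eqxx eq_sym (negPf ni2); ring.
- by rewrite evE !uE' (negPf ni21) eq_sym (negPf ni1); ring.
- by rewrite evE !uE' ![_ == i2]eq_sym (negPf ni21) (negPf ni2); ring.
Qed.
Lemma lin_D_unimodular_vector p a (psi : dual P) c (mu : dual P) d :
  mu p + a * d = 1 -> psi p + a * c = 0 -> lin_D p a psi c.
Proof.
apply: (@lin_D_unimodular R P (dual P) (fun p psi => psi p : R)).
- by move=> r q q' chi; exact: dual_scalar.
- by [].
- exact: lin_D_addr.
- exact: lin_D_addl.
- exact: lin_D_scale.
- exact: lin_D_commutator.
- exact: lin_D_elemr.
- exact: lin_D_eleml.
- exact: lin_rank2_local.
Qed.

Lemma lin_D_unimodular_dual p a (psi : dual P) c y b :
  psi y + c * b = 1 -> psi p + c * a = 0 -> lin_D p a psi c.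
Proof.
pose D chi k q d := lin_D q d chi k.
move=> phiy phiq; apply: (@lin_D_unimodular R (dual P) P (fun psi p => psi p : R)
  _ _ D _ _ _ _ _ _ _ psi c p a y b phiy phiq).
- by [].
- by move=> r chi q q'; exact: dual_scalar.
- by move=> chi k q d q' d' qd qd'; apply: lin_D_addl; rewrite mulrC.
- by move=> chi k chi' k' q d qd qd'; apply: lin_D_addr; rewrite mulrC.
- by move=> r chi k q d; apply: iff_sym; exact: lin_D_scale.
- move=> chi k q d eta l q' d' kq kq' lq' Dq Dq'.
  (* With the roles exchanged the scalar multiplies the vector, so it is first moved to the
     functional. *)
  apply/lin_D_scale; rewrite (mulrC l d).
  by apply: lin_D_commutator; rewrite // mulrC.
- by move=> chi k q; exact: lin_D_eleml.
- by move=> chi q d; exact: lin_D_elemr.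
move=> I /lin_rank2_local[t [e1 [e2 [chi1 [chi2 [nIt e11 e22 e12 e21]]]]]].
by exists t, chi1, chi2, e1, e2.
Qed.

Lemma linT_eq_linET_normal : linT P = linET P /\ normal_subgroup (linET P) (linG P).
Proof.
have TE : linT P = linET P.
  apply: generated_eq => s.
    case=> -[p a] [phi []]; have [psi [c ->]] := dual_pair_surj phi.
    rewrite dual_pairE => phiq uni sE; apply: realizedP.
    have -> : s = transvection (p, a) (dual_pair psi c) :> (_ -> _) by apply/funext.
    case: uni => [[lambda]|[[y b]]].
      have [mu [d ->]] := dual_pair_surj lambda; rewrite dual_pairE => lamq.
      by apply: (@lin_D_unimodular_vector _ _ _ _ mu d); rewrite mulrC.
    by rewrite dual_pairE; move/lin_D_unimodular_dual; apply.
  case=> [[x xE]|[psi psiE]]; apply: sub_gen_smallest.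
    exists ((x, 0) : lin_sum P), (dual_pair 0 1); split.
    - by transitivity (0 + 1 * 0 : R); [|ring].
    - right; exists ((0, 1) : lin_sum P).
      by transitivity (0 + 1 * 1 : R); [|ring].
    move=> [p a]; rewrite xE; congr (_, _).
      by transitivity (p + (0 + 1 * a) *: x); [rewrite add0r mul1r|].
    by transitivity (a + (0 + 1 * a) * 0); [ring|].
  exists ((0, 1) : lin_sum P), (dual_pair psi 0); split.
  - by rewrite dual_pairE dual0; ring.
  - left; exists (dual_pair 0 1).
    by transitivity (0 + 1 * 1 : R); [|ring].
  move=> [p a]; rewrite psiE; congr (_, _).
    by transitivity (p + (psi p + 0 * a) *: 0); [rewrite scaler0 addr0|].
  by transitivity (a + (psi p + 0 * a) * 1); [ring|].
split=> //; rewrite -TE; apply: generated_normal => //.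
move=> g s _ [q [phi [phiq uni sE]]].
have fP : (fun y => phi ((g^-1)%g y) : R^o) \in @dual_pred R (lin_sum P).
  by apply/asboolP => a y z; rewrite (laut_linear (g^-1)%g) dual_scalar.
exists (g q), (Dual fP); split.
- by rewrite /= (laut_inv_funP g).1.
- case: uni => [uni|[x phix]]; [left; exact: unimodular_laut|right; exists (g x)].
  by rewrite /= (laut_inv_funP g).1.
move=> x /=; rewrite sE addrC laut_linear addrC; congr (_ + _).
exact: (laut_inv_funP g).2.
Qed.
End LinearAssembly.

Theorem theorem2 (R : comPzRingType) (P : lmodType R) :
  fin_gen P -> projective P ->
  [/\ (* linear case *)
      (exists2 n : nat, (3 <= n)%N & constant_rank (lin_sum P) n) ->
        linT P = linET P /\ normal_subgroup (linET P) (linG P),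
      (* symplectic case *)
      forall (h : bilin P) (m : nat),
        two_invertible R -> alternating_bilin h -> nonsingular h ->
        (3 <= m)%N -> symp_locally_hyperbolic h m ->
        sympT h = sympET h /\ normal_subgroup (sympET h) (sympG h)
    & (* orthogonal case *)
      forall (h : bilin P) (m : nat),
        two_invertible R -> symmetric_bilin h -> nonsingular h ->
        (3 <= m)%N -> orth_locally_hyperbolic h m ->
        orthT h = orthET h /\ normal_subgroup (orthET h) (orthG h)].
Proof.
move=> fgP projP; split.
- by case=> n n3 rankP; exact: (linT_eq_linET_normal fgP projP n3 rankP).
- by move=> h m [c cE] alth _ m3 hyph; exact: (sympT_eq_sympET_normal fgP cE alth m3 hyph).
- by move=> h m [c cE] symh nsh m3 hyph; exact: (orthT_eq_orthET_normal fgP cE symh nsh m3 hyph).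
Qed.
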